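(* Let $k\ge 1$ and $n_1,\dots,n_k\ge 1$ be integers. For $j=1,\dots,k$ let $B_j>O$ be a constant $n_j\times n_j$ Hermitian positive definite matrix. Let $\alpha_1,\dots,\alpha_{k+1},h\in\mathbb{C}$ satisfy $\Re(\alpha_j)>0$ for $j=1,\dots,k+1$ and $\Re\left(\sum_{j=1}^k(\alpha_j+n_j)+h\right)>0$. Let $E[\cdot]$ denote the average over the rectangular complex type-1 Dirichlet measure for $p=1$ with these parameters, on vectors $\tilde X_j\in\mathbb{C}^{n_j}$, and let $$\phi_9(\tilde X_1,\dots,\tilde X_k)=[\tilde X_1^{*}B_1\tilde X_1+\cdots+\tilde X_k^{*}B_k\tilde X_k]^{h}.$$ Then $$E[\phi_9]=\frac{\Gamma\left(\sum_{j=1}^k(\alpha_j+n_j)+h\right)}{\Gamma\left(\sum_{j=1}^k(\alpha_j+n_j)\right)}\,\frac{\Gamma\left(\sum_{j=1}^k(\alpha_j+n_j)+\alpha_{k+1}\right)}{\Gamma\left(\sum_{j=1}^k(\alpha_j+n_j)+\alpha_{k+1}+h\right)}.$$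
   Context: $A>O$ means the Hermitian matrix $A$ is positive definite; $\tilde X^{*}$ is the conjugate transpose, so $\tilde X_j^{*}B_j\tilde X_j$ is a nonnegative real scalar for $\tilde X_j\in\mathbb{C}^{n_j}$. For a complex vector variable $\tilde X\in\mathbb{C}^n$, $d\tilde X$ is Lebesgue measure on $\mathbb{R}^{2n}$. The rectangular complex type-1 Dirichlet measure for $p=1$ has density $$f_5(\tilde X_1,\dots,\tilde X_k)=\tilde G_k\left(\prod_{j=1}^k[\tilde X_j^{*}B_j\tilde X_j]^{\alpha_j}\right)\left(1-\tilde X_1^{*}B_1\tilde X_1-\cdots-\tilde X_k^{*}B_k\tilde X_k\right)^{\alpha_{k+1}-1}$$ on the set of nonzero vectors $\tilde X_j\in\mathbb{C}^{n_j}$ with $\tilde X_1^{*}B_1\tilde X_1+\cdots+\tilde X_k^{*}B_k\tilde X_k<1$, where $$\tilde G_k=\left\{\prod_{j=1}^k\det(B_j)\,\frac{\Gamma(n_j)}{\pi^{n_j}\,\Gamma(\alpha_j+n_j)}\right\}\frac{\Gamma(\alpha_1+\cdots+\alpha_{k+1}+n_1+\cdots+n_k)}{\Gamma(\alpha_{k+1})}.$$ The Dirichlet average of $\phi$ is $E[\phi]=\int\phi\,f_5\,d\tilde X_1\cdots d\tilde X_k$. *)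

(* Defs.v *)
From HB Require Import structures.
From mathcomp Require Import all_boot all_order all_algebra.
From mathcomp Require Import all_classical all_reals all_analysis.
From mathcomp Require Import complex.

Set Implicit Arguments.
Unset Strict Implicit.
Unset Printing Implicit Defensive.

Import Order.TTheory GRing.Theory Num.Theory.
Import numFieldNormedType.Exports.

Local Open Scope classical_set_scope.
Local Open Scope ring_scope.
Local Open Scope complex_scope.
Local Open Scope sesquilinear_scope.

(* The library infers this instance for subprobabilities only. *)
Lemma product_measure1_sigma_finite d1 d2 (T1 : measurableType d1)
    (T2 : measurableType d2) (R : realType)
    (m1 : {sigma_finite_measure set T1 -> \bar R})
    (m2 : {sigma_finite_measure set T2 -> \bar R}) :
  sigma_finite setT (m1 \x m2)%E.
Proof.
have /sigma_finiteP[F [TF ndF Foo]] := sigma_finiteT m1.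
have /sigma_finiteP[G [TG ndG Goo]] := sigma_finiteT m2.
exists (fun n => F n `*` G n).
  rewrite -setXTT TF TG predeqE => -[x y]; split.
    move=> [/= [n _ Fnx] [k _ Gky]]; exists (maxn n k) => //; split.
    - by move: x Fnx; exact/subsetPset/ndF/leq_maxl.
    - by move: y Gky; exact/subsetPset/ndG/leq_maxr.
  by move=> [n _ []/= ? ?]; split; exists n.
move=> k; have [? ?] := Foo k; have [? ?] := Goo k.
split; first exact: measurableX.
by rewrite product_measure1E// lte_mul_pinfty// ge0_fin_numE.
Qed.

Section cons_measure.
Local Open Scope ereal_scope.
Context d (T : measurableType d) (R : realType) (n : nat).
Variable mu : {sigma_finite_measure set T -> \bar R}.
Variable nu : {sigma_finite_measure set (n.-tuple T) -> \bar R}.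

Definition tcons (p : T * n.-tuple T) : n.+1.-tuple T :=
  [the n.+1.-tuple T of p.1 :: p.2].

Lemma measurable_tcons : measurable_fun [set: T * n.-tuple T] tcons.
Proof. exact: measurable_cons. Qed.

Definition cons_measure : set (n.+1.-tuple T) -> \bar R :=
  pushforward (mu \x nu) tcons.

Let cons_measure0 : cons_measure set0 = 0.
Proof. by rewrite /cons_measure /pushforward preimage_set0 measure0. Qed.

Let cons_measure_ge0 (A : set (n.+1.-tuple T)) : 0 <= cons_measure A.
Proof. by rewrite /cons_measure /pushforward; apply: measure_ge0. Qed.

Let measurable_tcons_preimage A :
  measurable A -> measurable (tcons @^-1` A).
Proof. by move=> mA; rewrite -[X in measurable X]setTI; exact: measurable_tcons. Qed.

Let cons_measure_sigma_additive : semi_sigma_additive cons_measure.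
Proof.
move=> F mF tF mUF; rewrite /cons_measure /pushforward preimage_bigcup.
apply: measure_semi_sigma_additive.
- by move=> i; exact: measurable_tcons_preimage.
- apply/trivIsetP => /= i j _ _ ij; rewrite -preimage_setI.
  by move/trivIsetP : tF => /(_ _ _ _ _ ij) ->//; rewrite preimage_set0.
- by rewrite -preimage_bigcup; exact: measurable_tcons_preimage.
Qed.

HB.instance Definition _ := isMeasure.Build _ _ _ cons_measure
  cons_measure0 cons_measure_ge0 cons_measure_sigma_additive.

Let tuncons (t : n.+1.-tuple T) : T * n.-tuple T :=
  (thead t, [tuple of behead t]).

Let tunconsK : cancel tuncons tcons.
Proof. by move=> t; rewrite [RHS]tuple_eta; apply/val_inj. Qed.

Let tconsK : cancel tcons tuncons.
Proof. by case=> x t; rewrite /tuncons theadE; congr pair; apply/val_inj. Qed.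

Let measurable_tuncons : measurable_fun setT tuncons.
Proof.
apply/measurable_fun_pair; first exact: measurable_tnth.
exact: measurable_behead.
Qed.

Let cons_measure_sigma_finite : sigma_finite setT cons_measure.
Proof.
have [F FT Foo] := product_measure1_sigma_finite mu nu.
exists (fun i => tuncons @^-1` F i).
  by rewrite -preimage_bigcup -FT preimage_setT.
move=> i; have [mFi Fioo] := Foo i; split.
  by rewrite -[X in measurable X]setTI; exact: measurable_tuncons.
rewrite /cons_measure /pushforward.
by rewrite (_ : _ @^-1` _ = F i)//; apply/funext => p /=; rewrite tconsK.
Qed.

HB.instance Definition _ := Measure_isSigmaFinite.Build _ _ _ cons_measure
  cons_measure_sigma_finite.

Lemma cons_measureX (A : set T) (C : set (n.-tuple T)) :
  measurable A -> measurable C ->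
  cons_measure [set t | A (thead t) /\ C [tuple of behead t]] = mu A * nu C.
Proof.
move=> mA mC; rewrite -product_measure1E//= /cons_measure /pushforward.
congr ((mu \x nu)%E _); apply/funext => -[x t] /=; rewrite theadE.
by congr (_ /\ C _); apply/val_inj.
Qed.

End cons_measure.

Section prod_tuple_measure.
Local Open Scope ereal_scope.
Context d (T : measurableType d) (R : realType).
Variable mu : {sigma_finite_measure set T -> \bar R}.

(* The n-fold product measure of mu with itself. *)
Fixpoint prod_tuple_measure n : {sigma_finite_measure set (n.-tuple T) -> \bar R} :=
  match n with
  | 0 => \d_([tuple] : 0.-tuple T)
  | m.+1 => cons_measure mu (prod_tuple_measure m)
  end.

Lemma prod_tuple_measureE n (A : 'I_n -> set T) :
  (forall i, measurable (A i)) ->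
  prod_tuple_measure n [set t | forall i, A i (tnth t i)] =
  \prod_(i < n) mu (A i).
Proof.
elim: n A => [|n IHn] A mA.
  by rewrite big_ord0 /= diracE mem_set//= => -[].
have mB : measurable [set t : n.-tuple T | forall i, A (lift ord0 i) (tnth t i)].
  rewrite (_ : mkset _ =
    \big[setI/setT]_(i < n) ((fun t : n.-tuple T => tnth t i) @^-1` A (lift ord0 i))).
    apply: bigsetI_measurable => i _; rewrite -[X in measurable X]setTI.
    exact: measurable_tnth.
  rewrite -bigcap_seq; apply/seteqP; split => t /= tA i; first by move=> _; exact: tA.
  by apply: tA; rewrite /= mem_index_enum.
rewrite big_ord_recl -IHn// -cons_measureX//=.
congr (cons_measure _ _ _); apply/seteqP; split => t /=.
  move=> tA; split; first exact: tA.
  by move=> i; have := tA (lift ord0 i); rewrite [in tnth t _](tuple_eta t) tnthS.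
move=> [t0 tA] i; case: (unliftP ord0 i) => [j|] -> //.
by have := tA j; rewrite [in tnth t _](tuple_eta t) tnthS.
Qed.

End prod_tuple_measure.

Section complex_integral.
Context d (T : measurableType d) (R : realType).
Variable mu : {measure set T -> \bar R}.
Implicit Types (D : set T) (f : T -> R[i]).

Definition cintegrable D f : Prop :=
  mu.-integrable D (EFin \o (@complex.Re R \o f)) /\
  mu.-integrable D (EFin \o (@complex.Im R \o f)).

Definition cintegral D f : R[i] :=
  (\int[mu]_(x in D) complex.Re (f x)) +i* (\int[mu]_(x in D) complex.Im (f x)).

End complex_integral.

Section complex_functions.
Context {R : realType}.

Definition cexp (z : R[i]) : R[i] :=
  (expR (complex.Re z))%:C * (cos (complex.Im z) +i* sin (complex.Im z)).

(* Principal value of x ^ a; meaningful for x > 0 only, since ln x = 0 for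
   x <= 0. *)
Definition cpow (x : R) (a : R[i]) : R[i] := cexp (a * (ln x)%:C).

(* Euler's integral; it represents the Gamma function on Re z > 0 only. *)
Definition cGamma (z : R[i]) : R[i] :=
  cintegral (@lebesgue_measure R) `]0, +oo[
    (fun t : R => cpow t (z - 1) * (expR (- t))%:C).

End complex_functions.

Section complex_lebesgue.
Context (R : realType).
Local Notation RT := (measurableTypeR R).

(* Lebesgue measure on C, with x + iy represented by the pair (x, y). *)
Definition lebesgue_measureC : set (RT * RT) -> \bar R :=
  (@lebesgue_measure R \x @lebesgue_measure R)%E.

HB.instance Definition _ := Measure.on lebesgue_measureC.

HB.instance Definition _ := Measure_isSigmaFinite.Build _ _ _ lebesgue_measureC
  (product_measure1_sigma_finite (@lebesgue_measure R) (@lebesgue_measure R)).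

(* Lebesgue measure on C^N, i.e. on R^(2N). *)
Definition lebesgue_measureCn (N : nat) :
    {sigma_finite_measure set (N.-tuple (RT * RT)) -> \bar R} :=
  prod_tuple_measure lebesgue_measureC N.

Definition cvec_of_tuple (N : nat) (t : N.-tuple (RT * RT)) : 'cV[R[i]]_N :=
  \col_i ((tnth t i).1 +i* (tnth t i).2).

End complex_lebesgue.

Section dirichlet.
Context {R : realType}.

Definition posdefmx (m : nat) (A : 'M[R[i]]_m) : Prop :=
  A \is hermsymmx /\
  (forall x : 'cV[R[i]]_m, x != 0 -> 0 < (x ^t* *m A *m x) 0 0).

(* X^* A X, which is real for Hermitian A. *)
Definition quadform (m : nat) (A : 'M[R[i]]_m) (X : 'cV[R[i]]_m) : R :=
  complex.Re ((X ^t* *m A *m X) 0 0).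

Variables (k : nat) (n : 'I_k -> nat) (B : forall j, 'M[R[i]]_(n j)).
Variable alpha : 'I_k.+1 -> R[i].

(* 'I_k.+1 indexes alpha_1, ..., alpha_{k+1}: [alpha (inj j)] for j : 'I_k are
   the first k of them and [alpha ord_max] is the last one. *)
Local Notation inj := (widen_ord (leqnSn k)).

Definition dirichlet_const : R[i] :=
  (\prod_(j < k) (\det (B j) *
     (cGamma (n j)%:R / ((pi ^+ n j)%:C * cGamma (alpha (inj j) + (n j)%:R))))) *
  (cGamma (\sum_(j < k.+1) alpha j + \sum_(j < k) (n j)%:R) /
   cGamma (alpha ord_max)).

Definition dirichlet_density (X : forall j, 'cV[R[i]]_(n j)) : R[i] :=
  dirichlet_const *
  (\prod_(j < k) cpow (quadform (B j) (X j)) (alpha (inj j))) *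
  cpow (1 - \sum_(j < k) quadform (B j) (X j)) (alpha ord_max - 1).

Definition dirichlet_domain (X : forall j, 'cV[R[i]]_(n j)) : Prop :=
  (forall j, X j != 0) /\ \sum_(j < k) quadform (B j) (X j) < 1.

(* C^(n_1) x ... x C^(n_k) is identified with C^(n_1 + ... + n_k), whose vectors
   are cut back into the blocks X_1, ..., X_k. *)
Let N := (\sum_(j < k) n j)%N.

Definition blocks (t : N.-tuple (measurableTypeR R * measurableTypeR R))
    (j : 'I_k) : 'cV[R[i]]_(n j) :=
  submxcol (cvec_of_tuple t) j.

Definition dirichlet_integrable (phi : (forall j, 'cV[R[i]]_(n j)) -> R[i]) : Prop :=
  cintegrable (lebesgue_measureCn R N) [set t | dirichlet_domain (blocks t)]
    (fun t => phi (blocks t) * dirichlet_density (blocks t)).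

Definition dirichlet_average (phi : (forall j, 'cV[R[i]]_(n j)) -> R[i]) : R[i] :=
  cintegral (lebesgue_measureCn R N) [set t | dirichlet_domain (blocks t)]
    (fun t => phi (blocks t) * dirichlet_density (blocks t)).

Definition phi9 (h : R[i]) (X : forall j, 'cV[R[i]]_(n j)) : R[i] :=
  cpow (\sum_(j < k) quadform (B j) (X j)) h.

End dirichlet.

(* Main.v *)
Require Import Defs.
From mathcomp Require Import all_boot all_order all_algebra.
From mathcomp Require Import all_classical all_reals all_analysis.
From mathcomp Require Import measurable_realfun complex.
From mathcomp Require Import ring lra.

(* Call a weighted measure w.mu radial for q, with parameters s and C, when its
   image under q is C r ^ (s - 1) / Gamma(s) dr on the positive half-line.
   Multiplying w by q ^ a shifts s by a, and sums of independent blocks add the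
   parameters and multiply the constants, because these kernels form a
   convolution semigroup (Beta(s, t) Gamma(s + t) = Gamma(s) Gamma(t)). Lebesgue
   measure on C is radial for b|z|^2 with s = 1 and C = pi / b, so completing the
   square one coordinate at a time makes Lebesgue measure on C^n radial for
   X^* B X with s = n and C = pi^n / det B. The Dirichlet average is thereby the
   one-dimensional integral of r ^ (s + h - 1) (1 - r) ^ (a - 1) over (0, 1), a
   Beta function. Dividing by Gamma requires Gamma(z) != 0 for Re z > 0. *)

Set Implicit Arguments.
Unset Strict Implicit.
Unset Printing Implicit Defensive.

Import Order.TTheory GRing.Theory Num.Theory.
Import numFieldNormedType.Exports.

Local Open Scope classical_set_scope.
Local Open Scope ring_scope.
Local Open Scope complex_scope.

(** The parameters are complex, hence so are the weighted measures, whereas Tonelli, the scaling of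
    Lebesgue measure and the uniqueness of measures concern nonnegative quantities. The main
    identities are therefore established twice: for moduli, as equalities of nonnegative extended
    integrals, which give absolute integrability, and then for the complex integrals, where Fubini
    and linearity have become available. Powers are cut off to [0] on the nonpositive half-line, so
    that the constraints of the Dirichlet domain become part of the integrand.

    [cGamma] is Euler's integral, so everything about it is derived on Re z > 0. The functional
    equation comes from Beta(z, 1) = 1 / z. Adding 1 to z leaves Im z fixed, so zeros need only be
    excluded where Re z is large compared with Im z and the integrand oscillates too little to
    cancel. The constant pi enters as the area of the unit disc, identified by integrating a
    Gaussian over the plane. *)

Local Notation normc := ComplexField.Normc.normc.

(** * Complex-valued integrals *)

Section complex_valued_functions.
Context d (T : measurableType d) (R : realType).
Implicit Types (f g : T -> R[i]) (u : T -> R) (z : R[i]).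

Definition cmeasurable f :=
  measurable_fun setT (@complex.Re R \o f) /\
  measurable_fun setT (@complex.Im R \o f).

Lemma cmeasurable_cst z : cmeasurable (fun=> z).
Proof. by split; exact: measurable_cst. Qed.

Lemma cmeasurableM f g :
  cmeasurable f -> cmeasurable g -> cmeasurable (fun x => f x * g x).
Proof.
move=> [f1 f2] [g1 g2]; split.
  rewrite (_ : _ \o _ = fun x => complex.Re (f x) * complex.Re (g x) -
    complex.Im (f x) * complex.Im (g x)); last first.
    by apply/funext => x /=; case: (f x) => ? ?; case: (g x).
  by apply: measurable_funB; exact: measurable_funM.
rewrite (_ : _ \o _ = fun x => complex.Re (f x) * complex.Im (g x) +
    complex.Im (f x) * complex.Re (g x)); last first.
  by apply/funext => x /=; case: (f x) => ? ?; case: (g x).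
by apply: measurable_funD; exact: measurable_funM.
Qed.

Lemma cmeasurableD f g :
  cmeasurable f -> cmeasurable g -> cmeasurable (fun x => f x + g x).
Proof.
move=> [f1 f2] [g1 g2]; split.
  rewrite (_ : _ \o _ = fun x => complex.Re (f x) + complex.Re (g x)).
    exact: measurable_funD.
  by apply/funext => x /=; case: (f x); case: (g x).
rewrite (_ : _ \o _ = fun x => complex.Im (f x) + complex.Im (g x)).
  exact: measurable_funD.
by apply/funext => x /=; case: (f x); case: (g x).
Qed.

Lemma cmeasurable_prod (I : Type) (s : seq I) (F : I -> T -> R[i]) :
  (forall i, cmeasurable (F i)) -> cmeasurable (fun x => \prod_(i <- s) F i x).
Proof.
move=> mF; elim: s => [|i s IH].
  by under eq_fun do rewrite big_nil; exact: cmeasurable_cst.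
by under eq_fun do rewrite big_cons; exact: cmeasurableM.
Qed.

Lemma cmeasurable_real u :
  measurable_fun setT u -> cmeasurable (fun x => (u x)%:C).
Proof. by move=> mu; split => //; exact: measurable_cst. Qed.

Lemma cmeasurable_if (b : T -> bool) f g : measurable_fun setT b ->
  cmeasurable f -> cmeasurable g -> cmeasurable (fun x => if b x then f x else g x).
Proof.
move=> mb [f1 f2] [g1 g2]; split.
  rewrite (_ : _ \o _ = fun x => if b x then complex.Re (f x) else complex.Re (g x)).
    exact: measurable_fun_ifT.
  by apply/funext => x /=; case: ifP.
rewrite (_ : _ \o _ = fun x => if b x then complex.Im (f x) else complex.Im (g x)).
  exact: measurable_fun_ifT.
by apply/funext => x /=; case: ifP.
Qed.

Lemma normcE z : normc z = Num.sqrt (complex.Re z ^+ 2 + complex.Im z ^+ 2).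
Proof. by case: z. Qed.

Lemma normc_ge0 z : 0 <= normc z.
Proof. by rewrite normcE sqrtr_ge0. Qed.

Lemma ler_Re_normc z : `|complex.Re z| <= normc z.
Proof. by rewrite normcE -sqrtr_sqr ler_wsqrtr// lerDl sqr_ge0. Qed.

Lemma ler_Im_normc z : `|complex.Im z| <= normc z.
Proof. by rewrite normcE -sqrtr_sqr ler_wsqrtr// lerDr sqr_ge0. Qed.

Lemma normc_leD z : normc z <= `|complex.Re z| + `|complex.Im z|.
Proof.
rewrite normcE -[leRHS]ger0_norm ?addr_ge0// -sqrtr_sqr ler_wsqrtr//.
rewrite sqrrD !real_normK ?num_real// -addrA lerD2l lerDr.
by rewrite mulrn_wge0// mulr_ge0.
Qed.

Lemma normc_real (r : R) : normc r%:C = `|r|.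
Proof. by rewrite normcE /= expr0n addr0 sqrtr_sqr. Qed.

Lemma measurable_normc f :
  cmeasurable f -> measurable_fun setT (fun x => normc (f x)).
Proof.
move=> [f1 f2]; under eq_fun do rewrite normcE.
apply: (measurableT_comp (@continuous_measurable_fun R _ (@sqrt_continuous R))).
by apply: measurable_funD; exact: measurable_funX.
Qed.

Lemma emeasurable_normc f :
  cmeasurable f -> measurable_fun setT (fun x => (normc (f x))%:E).
Proof. by move=> mf; apply/measurable_EFinP; exact: measurable_normc. Qed.

End complex_valued_functions.

Lemma cmeasurableT_comp d1 d2 (T1 : measurableType d1) (T2 : measurableType d2)
    (R : realType) (f : T2 -> R[i]) (h : T1 -> T2) :
  cmeasurable f -> measurable_fun setT h -> cmeasurable (fun x => f (h x)).
Proof.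
by move=> [f1 f2] mh; split;
  [exact: (measurableT_comp f1)|exact: (measurableT_comp f2)].
Qed.

Section complex_integration.
Context d (T : measurableType d) (R : realType).
Variable mu : {measure set T -> \bar R}.
Implicit Types (f g : T -> R[i]) (u : T -> R) (z w : R[i]).

(** [|Re z|] and [|Im z|] are at most the modulus, which is at most their sum. Two integrability
    conditions are thereby replaced by the finiteness of one nonnegative integral, to which Tonelli
    and changes of variable apply unconditionally. *)
Lemma cintegrableP f : cmeasurable f ->
  cintegrable mu setT f <-> (\int[mu]_x (normc (f x))%:E < +oo)%E.
Proof.
move=> mf; have [mf1 mf2] := mf; split=> [[i1 i2]|lty]; last first.
  split; (apply/integrableP; split; [exact/measurable_EFinP|]).
    apply: le_lt_trans lty; apply: ge0_le_integral => //.
    - exact/measurableT_comp/measurable_EFinP.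
    - exact: emeasurable_normc.
    - by move=> x _ /=; rewrite lee_fin ler_Re_normc.
  apply: le_lt_trans lty; apply: ge0_le_integral => //.
  - exact/measurableT_comp/measurable_EFinP.
  - exact: emeasurable_normc.
  - by move=> x _ /=; rewrite lee_fin ler_Im_normc.
have /integrableP[_] := integrableD measurableT (integrable_abse i1) (integrable_abse i2).
apply: le_lt_trans; apply: ge0_le_integral => //.
- by move=> x _; rewrite lee_fin normc_ge0.
- exact: emeasurable_normc.
- apply: measurableT_comp => //; apply: emeasurable_funD;
  exact/measurableT_comp/measurable_EFinP.
- by move=> x _ /=; rewrite lee_fin (le_trans (normc_leD _))// ler_norm.
Qed.

Lemma Re_cM z w :
  complex.Re (z * w) = complex.Re z * complex.Re w - complex.Im z * complex.Im w.
Proof. by case: z; case: w. Qed.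

Lemma Im_cM z w :
  complex.Im (z * w) = complex.Re z * complex.Im w + complex.Im z * complex.Re w.
Proof. by case: z; case: w. Qed.

Lemma cintegrableM z f :
  cintegrable mu setT f -> cintegrable mu setT (fun x => z * f x).
Proof.
case=> i1 i2.
have h1 c := integrableZl measurableT c i1.
have h2 c := integrableZl measurableT c i2.
split.
  rewrite (_ : _ \o _ = (fun x => (complex.Re z)%:E * (complex.Re (f x))%:E) \-
    (fun x => (complex.Im z)%:E * (complex.Im (f x))%:E))%E; first exact: integrableB.
  by apply/funext => x; rewrite /= Re_cM EFinB !EFinM.
rewrite (_ : _ \o _ = (fun x => (complex.Re z)%:E * (complex.Im (f x))%:E) \+
  (fun x => (complex.Im z)%:E * (complex.Re (f x))%:E))%E; first exact: integrableD.
by apply/funext => x; rewrite /= Im_cM EFinD !EFinM.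
Qed.

Lemma cintegrableD f g : cintegrable mu setT f -> cintegrable mu setT g ->
  cintegrable mu setT (fun x => f x + g x).
Proof.
case=> f1 f2 [g1 g2]; split.
  apply: (@eq_integrable _ _ _ mu _ measurableT _ _ _ (integrableD measurableT f1 g1)).
  by move=> x _ /=; case: (f x); case: (g x).
apply: (@eq_integrable _ _ _ mu _ measurableT _ _ _ (integrableD measurableT f2 g2)).
by move=> x _ /=; case: (f x); case: (g x).
Qed.

Lemma cintegralM z f : cintegrable mu setT f ->
  cintegral mu setT (fun x => z * f x) = z * cintegral mu setT f.
Proof.
case=> i1 i2; apply/eqP; rewrite eq_complex Re_cM Im_cM /=.
have h1 c : mu.-integrable setT (EFin \o (fun x => c * complex.Re (f x))).
  by rewrite (_ : _ \o _ = fun x => c%:E * (complex.Re (f x))%:E)%E//; exact: integrableZl.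
have h2 c : mu.-integrable setT (EFin \o (fun x => c * complex.Im (f x))).
  by rewrite (_ : _ \o _ = fun x => c%:E * (complex.Im (f x))%:E)%E//; exact: integrableZl.
under eq_fun do rewrite Re_cM.
under [X in _ && (Rintegral _ _ X == _)]eq_fun do rewrite Im_cM.
by rewrite RintegralB// RintegralD// !RintegralZl// !eqxx.
Qed.

Lemma cintegralD f g : cintegrable mu setT f -> cintegrable mu setT g ->
  cintegral mu setT (fun x => f x + g x) = cintegral mu setT f + cintegral mu setT g.
Proof.
case=> f1 f2 [g1 g2]; apply/eqP; rewrite eq_complex /=; apply/andP; split.
  rewrite -RintegralD//; apply/eqP; apply: eq_Rintegral => x _.
  by case: (f x); case: (g x).
rewrite -RintegralD//; apply/eqP; apply: eq_Rintegral => x _.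
by case: (f x); case: (g x).
Qed.

Lemma cintegral_real u :
  cintegral mu setT (fun x => (u x)%:C) = (\int[mu]_x u x)%:C.
Proof. by rewrite /cintegral /= Rintegral_cst// mul0r. Qed.

Lemma cintegral_mkcond (D : set T) f :
  cintegral mu D f = cintegral mu setT (fun x => if x \in D then f x else 0).
Proof.
rewrite /cintegral Rintegral_mkcond [X in _ +i* X]Rintegral_mkcond.
congr (_ +i* _); apply: eq_Rintegral => x _; rewrite patchE; by case: ifP.
Qed.

Lemma cintegrable_mkcond (D : set T) f : measurable D ->
  cintegrable mu D f <->
  cintegrable mu setT (fun x => if x \in D then f x else 0).
Proof.
move=> mD; rewrite /cintegrable.
rewrite (integrable_mkcond (EFin \o (@complex.Re R \o f)) mD).
rewrite (integrable_mkcond (EFin \o (@complex.Im R \o f)) mD).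
rewrite (_ : (EFin \o (@complex.Re R \o f)) \_ D =
  EFin \o (@complex.Re R \o (fun x : T => if x \in D then f x else 0))); last first.
  by apply/funext => x; rewrite patchE /=; case: ifP.
rewrite (_ : (EFin \o (@complex.Im R \o f)) \_ D =
  EFin \o (@complex.Im R \o (fun x : T => if x \in D then f x else 0)))//.
by apply/funext => x; rewrite patchE /=; case: ifP.
Qed.

Lemma ae_eq_cintegral f g : cmeasurable f -> cmeasurable g ->
  {ae mu, forall x, f x = g x} -> cintegral mu setT f = cintegral mu setT g.
Proof.
move=> [f1 f2] [g1 g2] fg; rewrite /cintegral /Rintegral; congr (fine _ +i* fine _).
  apply: ae_eq_integral => //; [exact/measurable_EFinP|exact/measurable_EFinP|].
  by apply: filterS fg => x /= -> _.
apply: ae_eq_integral => //; [exact/measurable_EFinP|exact/measurable_EFinP|].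
by apply: filterS fg => x /= -> _.
Qed.

End complex_integration.

Section complex_fubini.
Context d1 d2 (T1 : measurableType d1) (T2 : measurableType d2) (R : realType).
Variable m1 : {sigma_finite_measure set T1 -> \bar R}.
Variable m2 : {sigma_finite_measure set T2 -> \bar R}.
Variable f : T1 * T2 -> R[i].
Hypothesis intf : cintegrable (m1 \x m2)%E setT f.

Lemma ae_cintegrable2 : {ae m2, forall y, cintegrable m1 setT (fun x => f (x, y))}.
Proof.
case: intf => i1 i2.
by apply: filterS2 (ae_integrable2 i1) (ae_integrable2 i2) => y ? ?; split.
Qed.

Lemma cmeasurable_cintegral2 :
  cmeasurable (fun y => cintegral m1 setT (fun x => f (x, y))).
Proof.
by case: intf => i1 i2; split;
  [have mG := measurable_fubini_G i1|have mG := measurable_fubini_G i2];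
  apply: (measurableT_comp _ mG); exact: fine_measurable.
Qed.

Lemma cmeasurable_cintegral1 :
  cmeasurable (fun x => cintegral m2 setT (fun y => f (x, y))).
Proof.
by case: intf => i1 i2; split;
  [have mG := measurable_fubini_F i1|have mG := measurable_fubini_F i2];
  apply: (measurableT_comp _ mG); exact: fine_measurable.
Qed.

Lemma cintegral_prod2 :
  cintegral (m1 \x m2)%E setT f =
  cintegral m2 setT (fun y => cintegral m1 setT (fun x => f (x, y))).
Proof.
case: intf => i1 i2; have [m1f m2f] := cmeasurable_cintegral2.
rewrite /cintegral /= /Rintegral; congr (fine _ +i* fine _).
  rewrite -(integral21_prod_meas1 i1).
  apply: ae_eq_integral => //; [exact: (measurable_fubini_G i1)|exact/measurable_EFinP|].
  (* The inner extended integral is finite only for almost every [y]; on the exceptional null set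
     [fine] may turn an infinite value into [0], which does not affect the outer integral. *)
  apply: filterS (ae_integrable2 i1) => y h _.
  by rewrite fineK//; exact: integrable_fin_num.
rewrite -(integral21_prod_meas1 i2).
apply: ae_eq_integral => //; [exact: (measurable_fubini_G i2)|exact/measurable_EFinP|].
apply: filterS (ae_integrable2 i2) => y h _.
by rewrite fineK//; exact: integrable_fin_num.
Qed.

Lemma cintegral_prod1 :
  cintegral (m1 \x m2)%E setT f =
  cintegral m1 setT (fun x => cintegral m2 setT (fun y => f (x, y))).
Proof.
case: intf => i1 i2; have [m1f m2f] := cmeasurable_cintegral1.
rewrite /cintegral /= /Rintegral; congr (fine _ +i* fine _).
  rewrite -(integral12_prod_meas1 i1).
  apply: ae_eq_integral => //; [exact: (measurable_fubini_F i1)|exact/measurable_EFinP|].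
  apply: filterS (ae_integrable1 i1) => y h _.
  by rewrite fineK//; exact: integrable_fin_num.
rewrite -(integral12_prod_meas1 i2).
apply: ae_eq_integral => //; [exact: (measurable_fubini_F i2)|exact/measurable_EFinP|].
apply: filterS (ae_integrable1 i2) => y h _.
by rewrite fineK//; exact: integrable_fin_num.
Qed.

End complex_fubini.

Section complex_pushforward.
Context d1 d2 (T1 : measurableType d1) (T2 : measurableType d2) (R : realType).
Variables (mu : {measure set T1 -> \bar R}) (nu : {measure set T2 -> \bar R}).
Variable phi : T1 -> T2.
Hypothesis mphi : measurable_fun setT phi.
Hypothesis nuE : forall A, measurable A -> nu A = mu (phi @^-1` A).

Lemma ge0_integral_image (f : T2 -> \bar R) :
  measurable_fun setT f -> (forall y, 0 <= f y)%E ->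
  (\int[nu]_y f y = \int[mu]_x f (phi x))%E.
Proof.
move=> mf f0; transitivity (\int[pushforward mu phi]_y f y)%E.
  by apply: eq_measure_integral => A mA _; rewrite nuE.
by rewrite ge0_integral_pushforward.
Qed.

(** This holds without integrability: positive and negative parts are transported as nonnegative
    integrals, and both sides form the same extended difference before [fine] is taken. *)
Lemma cintegral_image (f : T2 -> R[i]) : cmeasurable f ->
  cintegral nu setT f = cintegral mu setT (fun x => f (phi x)).
Proof.
have key (u : T2 -> R) : measurable_fun setT u ->
    \int[nu]_y u y = \int[mu]_x u (phi x).
  move=> mu_; have mE : measurable_fun setT (EFin \o u) by exact/measurable_EFinP.
  rewrite /Rintegral integralE [in RHS]integralE; congr (fine (_ - _)%E).
    rewrite (ge0_integral_image (measurable_funepos mE) (funepos_ge0 _)).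
    by apply: eq_integral => x _; rewrite !funeposE.
  rewrite (ge0_integral_image (measurable_funeneg mE) (funeneg_ge0 _)).
  by apply: eq_integral => x _; rewrite !funenegE.
by move=> [f1 f2]; rewrite /cintegral -(key _ f1) -(key _ f2).
Qed.

End complex_pushforward.

(** * Affine substitutions on the line *)

Section lebesgue_affine.
Context {R : realType}.
Local Notation leb := (@lebesgue_measure R).
Variables (a b : R).
Hypothesis a0 : 0 < a.

Let phi (x : measurableTypeR R) : measurableTypeR R := a * x + b.

Let mphi : measurable_fun setT phi.
Proof. by apply: measurable_funD => //; exact: measurable_funM. Qed.

(** As a function of [X] the right-hand side is a measure that gives each half-open interval its
    length, and Lebesgue measure is the only one. *)
Lemma lebesgue_measure_affine (X : set R) : measurable X ->
  (leb X = a%:E * leb ((fun x => a * x + b)%R @^-1` X))%E.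
Proof.
move=> mX; transitivity (pushforward (mscale (NngNum (ltW a0)) leb) phi X) => //.
apply: lebesgue_measure_unique mX => _ [[u v]] _ <-.
transitivity (a%:E * leb (phi @^-1` `]u, v]))%E; last by [].
rewrite (_ : phi @^-1` _ = `]((u - b) / a), ((v - b) / a)]%classic); last first.
  apply/seteqP; split => x /=; rewrite !in_itv /= /phi ltr_pdivrMr// ler_pdivlMr//;
    by rewrite ltrBlDr lerBrDr mulrC.
rewrite !lebesgue_measure_itv /= !lte_fin ltr_pM2r ?invr_gt0// ltrD2r.
case: ifP => _; last by rewrite mule0.
rewrite -!EFinB -EFinM; congr EFin; field; exact: lt0r_neq0.
Qed.

Lemma ge0_integral_affine (f : R -> \bar R) :
  measurable_fun setT f -> (forall x, 0 <= f x)%E ->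
  (\int[leb]_x f (a * x + b)%R = (a^-1)%:E * \int[leb]_x f x)%E.
Proof.
move=> mf f0.
have -> : (\int[leb]_x f x = \int[mscale (NngNum (ltW a0)) leb]_x f (phi x))%E.
  by apply: ge0_integral_image => // X /lebesgue_measure_affine.
rewrite ge0_integral_mscale//; last exact: measurableT_comp.
by rewrite muleA -EFinM /= mulVf ?mul1e// gt_eqF.
Qed.

Lemma Rintegral_affine (u : R -> R) : leb.-integrable setT (EFin \o u) ->
  \int[leb]_x u (a * x + b) = a^-1 * \int[leb]_x u x.
Proof.
move=> iu; have mu_ := measurable_int _ iu.
have Hp := ge0_integral_affine (measurable_funepos mu_) (funepos_ge0 _).
have Hn := ge0_integral_affine (measurable_funeneg mu_) (funeneg_ge0 _).
rewrite /Rintegral integralE [in RHS]integralE.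
rewrite (_ : (\int[leb]_x (fun x => (u (a * x + b))%:E)^\+ x)%E =
  (\int[leb]_x (EFin \o u)^\+ (a * x + b)%R)%E); last first.
  by apply: eq_integral => x _; rewrite !funeposE.
rewrite (_ : (\int[leb]_x (fun x => (u (a * x + b))%:E)^\- x)%E =
  (\int[leb]_x (EFin \o u)^\- (a * x + b)%R)%E); last first.
  by apply: eq_integral => x _; rewrite !funenegE.
rewrite Hp Hn.
(* Integrability makes both parts finite, so that [a^-1] distributes over their difference. *)
have := integrable_pos_fin_num measurableT iu.
have := integrable_neg_fin_num measurableT iu.
move=> /fineK <- /fineK <-.
by rewrite -!EFinM -!EFinB /= mulrBr.
Qed.

Lemma cintegrable_affine (f : R -> R[i]) : cmeasurable f ->
  cintegrable leb setT f -> cintegrable leb setT (fun x => f (a * x + b)).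
Proof.
move=> mf fi; have {}fi := (cintegrableP leb mf).1 fi.
apply/cintegrableP; first exact: (cmeasurableT_comp mf mphi).
rewrite (ge0_integral_affine (f := fun x => (normc (f x))%:E)) ?lte_mul_pinfty//.
- by rewrite lee_fin invr_ge0 ltW.
- exact: emeasurable_normc.
- by move=> x; rewrite lee_fin normc_ge0.
Qed.

Lemma cintegral_affine (f : R -> R[i]) : cintegrable leb setT f ->
  cintegral leb setT (fun x => f (a * x + b)) = (a^-1)%:C * cintegral leb setT f.
Proof.
move=> [i1 i2]; rewrite /cintegral (Rintegral_affine i1) (Rintegral_affine i2).
by apply/eqP; rewrite eq_complex /= !mul0r subr0 addr0 !eqxx.
Qed.

End lebesgue_affine.

Section lebesgue_shift.
Context {R : realType}.
Local Notation leb := (@lebesgue_measure R).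

Lemma ge0_integral_shift (b : R) (f : R -> \bar R) :
  measurable_fun setT f -> (forall x, 0 <= f x)%E ->
  (\int[leb]_x f (x + b)%R = \int[leb]_x f x)%E.
Proof.
move=> mf f0; have := ge0_integral_affine b ltr01 mf f0.
by rewrite invr1 mul1e => <-; apply: eq_integral => x _; rewrite mul1r.
Qed.

Lemma cintegral_shift (b : R) (f : R -> R[i]) : cmeasurable f ->
  cintegral leb setT (fun x => f (x + b)) = cintegral leb setT f.
Proof.
move=> mf; apply/esym/cintegral_image => //.
  exact: measurable_funD.
move=> A mA; apply: etrans (lebesgue_measure_affine b ltr01 mA) _; rewrite mul1e.
by congr (leb _); apply/seteqP; split => x /=; rewrite mul1r.
Qed.

End lebesgue_shift.

(** * Complex powers of positive reals *)

Section complex_powers.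
Context {R : realType}.
Implicit Types (x y r t : R) (s z : R[i]).

Lemma cexpD s z : cexp (s + z) = cexp s * cexp z.
Proof.
case: s => a b; case: z => c d; rewrite /cexp /= expRD cosD sinD.
by apply/eqP; rewrite eq_complex /=; apply/andP; split; apply/eqP; ring.
Qed.

Lemma cexp0 : cexp (0 : R[i]) = 1.
Proof. by rewrite /cexp /= expR0 cos0 sin0 mul1r. Qed.

Lemma normc_cexp z : normc (cexp z) = expR (complex.Re z).
Proof.
rewrite /cexp ComplexField.Normc.normcM normc_real ger0_norm ?expR_ge0//.
by rewrite normcE /= cos2Dsin2 sqrtr1 mulr1.
Qed.

Lemma cpowD r s z : cpow r (s + z) = cpow r s * cpow r z.
Proof. by rewrite /cpow mulrDl cexpD. Qed.

Lemma cpow0 r : cpow r 0 = 1.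
Proof. by rewrite /cpow mul0r cexp0. Qed.

Lemma cpowM r t z : 0 < r -> 0 < t -> cpow (r * t) z = cpow r z * cpow t z.
Proof. by move=> r0 t0; rewrite /cpow lnM ?posrE// rmorphD /= mulrDr cexpD. Qed.

Lemma cpow_real r x : 0 < r -> cpow r x%:C = (r `^ x)%:C.
Proof.
move=> r0; have rn : (r == 0) = false by rewrite gt_eqF.
rewrite /powR rn; apply/eqP; rewrite eq_complex /=.
by rewrite !(mul0r, mulr0, subr0, addr0) cos0 sin0 !mulr0 mulr1 !eqxx.
Qed.

Lemma Re_cpow r z : complex.Re (cpow r z) =
  expR (complex.Re z * ln r) * cos (complex.Im z * ln r).
Proof. by rewrite /cpow /cexp; case: z => a b /=; rewrite !mulr0 subr0 mul0r add0r subr0. Qed.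

Lemma Im_cpow r z : complex.Im (cpow r z) =
  expR (complex.Re z * ln r) * sin (complex.Im z * ln r).
Proof. by rewrite /cpow /cexp; case: z => a b /=; rewrite !mulr0 subr0 mul0r add0r addr0. Qed.

Lemma normc_cpow r z : 0 < r -> normc (cpow r z) = r `^ complex.Re z.
Proof.
move=> r0; rewrite /cpow normc_cexp; case: z => a b /=.
by rewrite mulr0 subr0 /powR gt_eqF.
Qed.

Lemma cpow1r r : 0 < r -> cpow r 1 = r%:C.
Proof. by move=> r0; rewrite -[1 in LHS]/(1%:C) cpow_real// powRr1// ltW. Qed.

Lemma cpow_neq0 r z : cpow r z != 0.
Proof.
by apply/eqP => /(congr1 (@normc R)); rewrite /cpow normc_cexp ComplexField.Normc.normc0;
  apply/eqP; rewrite gt_eqF// expR_gt0.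
Qed.

Lemma measurable_cpow d (T : measurableType d) (u : T -> R) z :
  measurable_fun setT u -> cmeasurable (fun w => cpow (u w) z).
Proof.
move=> mu.
have mln c : measurable_fun setT (fun w => c * ln (u w)).
  by apply: measurable_funM => //; exact: measurableT_comp.
split.
  rewrite (_ : _ \o _ = fun w => expR (complex.Re z * ln (u w)) *
      cos (complex.Im z * ln (u w))); last by apply/funext => w; exact: Re_cpow.
  apply: measurable_funM; first exact: (measurableT_comp (@measurable_expR R)).
  apply: (measurableT_comp (continuous_measurable_fun _)) => //.
  exact: continuous_cos.
rewrite (_ : _ \o _ = fun w => expR (complex.Re z * ln (u w)) *
    sin (complex.Im z * ln (u w))); last by apply/funext => w; exact: Im_cpow.
apply: measurable_funM; first exact: (measurableT_comp (@measurable_expR R)).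
apply: (measurableT_comp (continuous_measurable_fun _)) => //.
exact: continuous_sin.
Qed.

Lemma cpowB1 r z : 0 < r -> cpow r (z - 1) = (r^-1)%:C * cpow r z.
Proof.
move=> r0; apply: (@mulfI _ (cpow r 1)); first exact: cpow_neq0.
rewrite -cpowD addrCA subrr addr0 mulrA cpow1r// -rmorphM /= divff ?mul1r//.
by rewrite gt_eqF.
Qed.

(** With [z = x + i y], the power is [exp(x ln t)] times [cos(y ln t) + i sin(y ln t)]. The product
    rule on each part gives the parts of [(z / r) r ^ z], and [cpowB1] moves [1 / r] into the
    exponent. *)
Lemma is_derive_cpow z r : 0 < r ->
  is_derive r 1 (fun t : R => complex.Re (cpow t z)) (complex.Re (z * cpow r (z - 1))) /\
  is_derive r 1 (fun t : R => complex.Im (cpow t z)) (complex.Im (z * cpow r (z - 1))).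
Proof.
move=> r0; have Dln := is_derive1_ln r0.
have D1 (a : R) : is_derive r 1 (fun t : R => a * ln t) (a * r^-1) by exact: is_deriveZ.
have DE (a : R) : is_derive r 1 (fun t : R => expR (a * ln t)) (expR (a * ln r) * (a * r^-1)).
  exact: (@is_derive1_comp _ expR (fun t => a * ln t)).
have DC (a : R) : is_derive r 1 (fun t : R => cos (a * ln t)) (- sin (a * ln r) * (a * r^-1)).
  exact: (@is_derive1_comp _ cos (fun t => a * ln t)).
have DS (a : R) : is_derive r 1 (fun t : R => sin (a * ln t)) (cos (a * ln r) * (a * r^-1)).
  exact: (@is_derive1_comp _ sin (fun t => a * ln t)).
have [reE imE] := (Re_cpow r z, Im_cpow r z); split.
  have DM := is_deriveM (DE (complex.Re z)) (DC (complex.Im z)).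
  rewrite (_ : (fun t => _) = (fun t => expR (complex.Re z * ln t)) *
    (fun t => cos (complex.Im z * ln t))); last first.
    by apply/funext => t; exact: Re_cpow.
  suff -> : complex.Re (z * cpow r (z - 1)) =
    expR (complex.Re z * ln r) *: (- sin (complex.Im z * ln r) * (complex.Im z * r^-1)) +
    cos (complex.Im z * ln r) *: (expR (complex.Re z * ln r) * (complex.Re z * r^-1)).
    exact: DM.
  move: reE imE; rewrite cpowB1//; case: (cpow r z) => u v /=;
  by case: (z) => a b /= -> ->; rewrite /GRing.scale /=; ring.
have DM := is_deriveM (DE (complex.Re z)) (DS (complex.Im z)).
rewrite (_ : (fun t => _) = (fun t => expR (complex.Re z * ln t)) *
  (fun t => sin (complex.Im z * ln t))); last first.
  by apply/funext => t; exact: Im_cpow.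
suff -> : complex.Im (z * cpow r (z - 1)) =
  expR (complex.Re z * ln r) *: (cos (complex.Im z * ln r) * (complex.Im z * r^-1)) +
  sin (complex.Im z * ln r) *: (expR (complex.Re z * ln r) * (complex.Re z * r^-1)).
  exact: DM.
move: reE imE; rewrite cpowB1//; case: (cpow r z) => u v /=.
by case: (z) => a b /= -> ->; rewrite /GRing.scale /=; ring.
Qed.

Lemma continuous_cpow z r : 0 < r ->
  {for r, continuous (fun t : R => complex.Re (cpow t z))} /\
  {for r, continuous (fun t : R => complex.Im (cpow t z))}.
Proof.
move=> r0; have [D1 D2] := is_derive_cpow z r0; split;
  by apply: differentiable_continuous; apply/derivable1_diffP; apply: ex_derive.
Qed.

(** The hypotheses hold on the open half-line, so the one-sided conditions at [q] and [1] follow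
    from two-sided ones. The bound [0 < q] avoids the singularity of [t ^ (z - 1)] at the origin. *)
Lemma FTC2_gt0 (F f : R -> R) (q : R) : 0 < q < 1 ->
  (forall t, 0 < t -> is_derive t 1 F (f t)) ->
  (forall t, 0 < t -> {for t, continuous f}) ->
  (\int[@lebesgue_measure R]_(t in `[q, 1%R]) (f t)%:E = (F 1 - F q)%R%:E)%E.
Proof.
move=> /andP[q0 q1] dF cf.
have cF t : 0 < t -> {for t, continuous F}.
  move=> t0; apply: differentiable_continuous; apply/derivable1_diffP.
  by have D := dF t t0; exact: ex_derive.
rewrite (@continuous_FTC2 _ f F)//.
- apply: continuous_in_subspaceT => t; rewrite inE /= in_itv /= => /andP[qt _].
  exact/cf/(lt_le_trans q0).
- split => [t||].
  + rewrite in_itv /= => /andP[qt _].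
    by have D := dF t (lt_trans q0 qt); exact: ex_derive.
  + by apply: cvg_at_right_filter; exact: cF.
  + by apply: cvg_at_left_filter; exact: cF.
- move=> t; rewrite in_itv /= => /andP[qt _].
  by rewrite derive1E; have D := dF t (lt_trans q0 qt); exact: derive_val.
Qed.

Lemma integral_cpow z q : 0 < q < 1 ->
  cintegral (@lebesgue_measure R) `[q, 1] (fun t => z * cpow t (z - 1)) =
  1 - cpow q z.
Proof.
move=> q01; have E1 : cpow 1 z = 1 by rewrite /cpow ln1 mulr0 cexp0.
rewrite /cintegral /Rintegral.
have cp t : 0 < t -> {for t, continuous (fun t : R => complex.Re (z * cpow t (z - 1)))} /\
    {for t, continuous (fun t : R => complex.Im (z * cpow t (z - 1)))}.
  move=> t0; have [c1 c2] := continuous_cpow (z - 1) t0; split.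
    rewrite (_ : (fun t => _) = fun t : R => complex.Re z * complex.Re (cpow t (z - 1)) -
        complex.Im z * complex.Im (cpow t (z - 1))); last first.
      by apply/funext => u; case: (z) => a b; case: (cpow u _).
    by apply: continuousB; apply: continuousM => //; exact: cst_continuous.
  rewrite (_ : (fun t => _) = fun t : R => complex.Re z * complex.Im (cpow t (z - 1)) +
      complex.Im z * complex.Re (cpow t (z - 1))); last first.
    by apply/funext => u; case: (z) => a b; case: (cpow u _).
  by apply: continuousD; apply: continuousM => //; exact: cst_continuous.
have := @FTC2_gt0 (fun t => complex.Re (cpow t z)) _ q
  q01 (fun t ht => (is_derive_cpow z ht).1) (fun t ht => (cp t ht).1).
have := @FTC2_gt0 (fun t => complex.Im (cpow t z)) _ q
  q01 (fun t ht => (is_derive_cpow z ht).2) (fun t ht => (cp t ht).2).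
move=> -> ->.
by rewrite E1; case: (cpow q z).
Qed.

End complex_powers.

(** * Beta and Gamma integrals *)

Section power_weights.
Context {R : realType}.
Local Notation leb := (@lebesgue_measure R).
Local Notation RT := (measurableTypeR R).
Implicit Types (s z : R[i]).

(** The cut-off turns integrals over half-lines and over [(0, r)] into integrals over the whole
    line, so that translations and Fubini need no domains. It has to be explicit because [cpow r z]
    is [1] for [r <= 0], where [ln r = 0]. *)
Definition wgt s (r : R) : R[i] := if 0 < r then cpow r (s - 1) else 0.

Definition rwgt (a r : R) : R := if 0 < r then r `^ (a - 1) else 0.

Lemma rwgt_ge0 (a r : R) : 0 <= rwgt a r.
Proof. by rewrite /rwgt; case: ifP => // _; exact: powR_ge0. Qed.

Lemma normc_wgt s r : normc (wgt s r) = rwgt (complex.Re s) r.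
Proof.
rewrite /wgt /rwgt; case: ifPn => r0; last by rewrite ComplexField.Normc.normc0.
by rewrite normc_cpow//; case: s.
Qed.

Lemma wgt_real (a r : R) : wgt a%:C r = (rwgt a r)%:C.
Proof.
rewrite /wgt /rwgt; case: ifPn => // r0.
by rewrite -cpow_real// rmorphB.
Qed.

Lemma measurable_wgt d (T : measurableType d) s (u : T -> R) :
  measurable_fun setT u -> cmeasurable (fun x => wgt s (u x)).
Proof.
move=> mu; apply: cmeasurable_if.
- exact: measurable_fun_ltr.
- exact: measurable_cpow.
- exact: cmeasurable_cst.
Qed.

Lemma measurable_rwgt d (T : measurableType d) (a : R) (u : T -> R) :
  measurable_fun setT u -> measurable_fun setT (fun x => rwgt a (u x)).
Proof.
move=> mu; apply: measurable_fun_ifT => //.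
- exact: measurable_fun_ltr.
- exact: (measurableT_comp (@measurable_powR R (a - 1))).
Qed.

Lemma wgtM s (c r : R) : 0 < c -> wgt s (c * r) = cpow c (s - 1) * wgt s r.
Proof.
move=> c0; rewrite /wgt pmulr_rgt0//; case: ifPn => r0; last by rewrite mulr0.
by rewrite cpowM.
Qed.

Lemma rwgtM (a c r : R) : 0 < c -> rwgt a (c * r) = c `^ (a - 1) * rwgt a r.
Proof.
move=> c0; rewrite /rwgt pmulr_rgt0//; case: ifPn => r0; last by rewrite mulr0.
by rewrite powRM// ltW.
Qed.

(** Kept as an extended number so that the convolution identities hold for all [a] and [b];
    finiteness for positive parameters is a later consequence ([eBetaE]). *)
Definition eBeta (a b : R) : \bar R :=
  (\int[leb]_t (rwgt a t * rwgt b (1 - t))%:E)%E.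

Lemma eBeta_ge0 (a b : R) : (0 <= eBeta a b)%E.
Proof. by apply: integral_ge0 => t _; rewrite lee_fin mulr_ge0 ?rwgt_ge0. Qed.

(** For [r <= 0] the two weights are never both nonzero. For [r > 0], replacing [t] by [r t]
    extracts [r] from the measure and [r ^ (a - 1)], [r ^ (b - 1)] from the weights, altogether
    [r ^ (a + b - 1)]. *)
Lemma integral_rwgt_conv (a b r : R) :
  (\int[leb]_t (rwgt a t * rwgt b (r - t)%R)%:E =
   (rwgt (a + b) r)%:E * eBeta a b)%E.
Proof.
have [r0|r0] := ltP 0 r; last first.
  rewrite [in RHS]/rwgt ltNge r0 /= mul0e.
  apply: integral0_eq => t _; rewrite /rwgt; case: ifPn => t0; last by rewrite mul0r.
  by rewrite subr_gt0 ltNge (le_trans r0 (ltW t0)) mulr0.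
have mf : measurable_fun setT (fun t : R => (rwgt a t * rwgt b (r - t)%R)%:E).
  apply/measurable_EFinP; apply: measurable_funM; first exact: measurable_rwgt.
  by apply: measurable_rwgt; apply: measurable_funB.
have f0 t : (0 <= (rwgt a t * rwgt b (r - t)%R)%:E)%E.
  by rewrite lee_fin mulr_ge0 ?rwgt_ge0.
have -> : (\int[leb]_t (rwgt a t * rwgt b (r - t)%R)%:E = r%:E *
    \int[leb]_t (rwgt a (r * t + 0) * rwgt b (r - (r * t + 0)))%:E)%E.
  by rewrite (ge0_integral_affine 0 r0 mf f0) muleA -EFinM mulfV ?mul1e// gt_eqF.
rewrite (_ : (\int[leb]_x _ = \int[leb]_x (((r `^ (a - 1) * r `^ (b - 1))%:E) *
    (rwgt a x * rwgt b (1 - x)%R)%:E))%E); last first.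
  apply: eq_integral => t _; rewrite addr0.
  rewrite -[X in (X - r * t)%R]mulr1 -mulrBr !rwgtM// -EFinM; congr EFin; ring.
rewrite ge0_integralZl//.
- rewrite muleA -EFinM; congr (_%:E * _)%E; rewrite /rwgt r0.
  have rD u v : r `^ (u + v) = r `^ u * r `^ v by rewrite powRD// (gt_eqF r0) implybT.
  rewrite -{1}[r]powRr1 ?(ltW r0)// -!rD; congr (_ `^ _); ring.
- apply/measurable_EFinP; apply: measurable_funM; first exact: measurable_rwgt.
  by apply: measurable_rwgt; apply: measurable_funB.
- by move=> t _; rewrite lee_fin mulr_ge0 ?rwgt_ge0.
- by rewrite lee_fin mulr_ge0 ?powR_ge0.
Qed.

Lemma ge0_integral_rwgt_conv (a b : R) (g : R -> \bar R) :
  measurable_fun setT g -> (forall r, 0 <= g r)%E ->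
  (\int[leb]_u \int[leb]_v ((rwgt a u * rwgt b v)%:E * g (u + v)%R) =
   eBeta a b * \int[leb]_r ((rwgt (a + b) r)%:E * g r))%E.
Proof.
move=> mg g0.
(* [h (u, r)] is the integrand after the substitution [r = u + v] at fixed [u]; exchanging the
   integrals then leaves a convolution in [u] inside. *)
pose h (p : RT * RT) := ((rwgt a p.1 * rwgt b (p.2 - p.1))%:E * g p.2)%E.
have mh : measurable_fun setT h.
  apply: emeasurable_funM; last exact: measurableT_comp.
  apply/measurable_EFinP; apply: measurable_funM; first exact: measurable_rwgt.
  by apply: measurable_rwgt; apply: measurable_funB.
have h0 p : (0 <= h p)%E by rewrite mule_ge0// lee_fin mulr_ge0// rwgt_ge0.
have mB := eBeta_ge0 a b.
have mr : measurable_fun setT (fun r : RT => ((rwgt (a + b) r)%:E * g r)%E).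
  by apply: emeasurable_funM => //; apply/measurable_EFinP; exact: measurable_rwgt.
transitivity (\int[leb]_u \int[leb]_r h (u, r))%E.
  apply: eq_integral => u _.
  apply: etrans (ge0_integral_shift u (f := fun r => h (u, r)) _ _); last 2 first.
  - exact: measurableT_comp.
  - by move=> r; exact: h0.
  by apply: eq_integral => v _; rewrite /h /= addrK addrC.
apply: (etrans (fubini_tonelli h mh h0)).
apply: (etrans _ (ge0_integralZl _ measurableT mr _ mB)); last first.
  by move=> r _; rewrite mule_ge0// lee_fin rwgt_ge0.
apply: eq_integral => r _; rewrite /h /=.
rewrite (ge0_integralZr _ measurableT); last 3 first.
- apply/measurable_EFinP; apply: measurable_funM; first exact: measurable_rwgt.
  by apply: measurable_rwgt; apply: measurable_funB.
- by move=> t _; rewrite lee_fin mulr_ge0 ?rwgt_ge0.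
- exact: g0.
by rewrite integral_rwgt_conv muleCA muleA.
Qed.

End power_weights.

Section real_gamma.
Context {R : realType}.
Local Notation leb := (@lebesgue_measure R).
Local Notation RT := (measurableTypeR R).

Definition eGamma (a : R) : \bar R :=
  (\int[leb]_t (rwgt a t * expR (- t))%:E)%E.

Lemma measurable_expRN : measurable_fun setT (fun t : RT => expR (- t)).
Proof. by apply: (measurableT_comp (@measurable_expR R)); exact: oppr_measurable. Qed.

Lemma measurable_gamma_integrand (a : R) :
  measurable_fun setT (fun t : RT => (rwgt a t * expR (- t))%:E).
Proof.
apply/measurable_EFinP; apply: measurable_funM; first exact: measurable_rwgt.
exact: measurable_expRN.
Qed.

Lemma integral_powR_itv (a q : R) : 0 < a -> 0 < q < 1 ->
  (\int[leb]_(t in `[q, 1%R]) (a * t `^ (a - 1))%:E <= 1)%E.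
Proof.
move=> a0 q01; rewrite (@FTC2_gt0 R (fun t => t `^ a) (fun t => a * t `^ (a - 1)) q q01).
- by rewrite lee_fin powR1 lerBlDr lerDl powR_ge0.
- move=> t t0; apply: continuousM; first exact: cst_continuous.
  have D := is_derive1_powR (a - 1) t0.
  by apply: differentiable_continuous; apply/derivable1_diffP; exact: ex_derive.
Qed.

Lemma integral_rwgt01 (a : R) : 0 < a ->
  (\int[leb]_(t in `]0%R, 1%R]) (a * rwgt a t)%:E <= 1)%E.
Proof.
move=> a0.
(* The singularity at [0] is approached by closed intervals. The index [i.+2] keeps the left
   endpoint strictly below [1], as [FTC2_gt0] demands. *)
pose F (i : nat) : set RT := `[(i.+2%:R)^-1, 1]%classic.
have F0 i t : F i t -> 0 < t.
  by rewrite /F /= in_itv /= => /andP[+ _]; apply: lt_le_trans; rewrite invr_gt0.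
have -> : `]0, 1]%classic = \bigcup_i F i.
  apply/seteqP; split => [t /=|t [i _ Fit]]; last first.
    by rewrite /= in_itv /= (F0 _ _ Fit); move: Fit; rewrite /F /= in_itv /= => /andP[].
  rewrite in_itv /= => /andP[t0 t1]; exists (Num.truncn t^-1) => //.
  rewrite /F /= in_itv /= t1 andbT invf_ple ?posrE//.
  by rewrite (le_trans (ltW (truncnS_gt _)))// ler_nat.
have nF : nondecreasing_seq F.
  move=> i j ij; rewrite subsetEset => t; rewrite /F /= !in_itv /= => /andP[it ->].
  by rewrite andbT (le_trans _ it)// lef_pV2 ?posrE// ler_nat.
have mF i : measurable (F i) by exact: measurable_itv.
have mf i : measurable_fun (F i) (fun t : RT => (a * rwgt a t)%:E).
  apply: measurable_funTS; apply/measurable_EFinP; apply: measurable_funM => //.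
  exact: measurable_rwgt.
have f0 i t : F i t -> (0 <= (a * rwgt a t)%:E)%E.
  by move=> _; rewrite lee_fin mulr_ge0 ?rwgt_ge0// ltW.
have cv := ge0_nondecreasing_set_cvg_integral nF mF mf f0 (mu := leb).
rewrite -(cvg_lim (@ereal_hausdorff R) cv); apply: lime_le.
  by apply/cvg_ex; eexists; exact: cv.
apply: nearW => i; rewrite (eq_integral (fun t : RT => (a * t `^ (a - 1))%:E)).
  by apply: integral_powR_itv => //; rewrite invr_gt0 ltr0n /= invf_lt1 ?ltr1n.
by move=> t; rewrite inE => /F0 t0; rewrite /rwgt t0.
Qed.

(** One factor [exp(-t / 2)] absorbs the power; the other is, up to a constant, the density of the
    exponential law of rate [1/2], whose integral is known. *)
Lemma rwgt_expRN_le (a : R) : exists2 M : R, 0 <= M & forall t : R, 1 < t ->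
  rwgt a t * expR (- t) <= M * exponential_pdf 2^-1 t.
Proof.
pose n := Num.truncn `|a - 1|.
(* The first [2] cancels the rate [1/2] in the density; the rest comes from
   [(t / 2) ^ n.+1 / (n.+1)! <= exp(t / 2)]. The exponent [n.+1] suffices because [a - 1 < n.+1] and
   [t > 1]. *)
exists (2 * (2 ^+ n.+1 * (n.+1)`!%:R)) => [|t t1].
  by rewrite mulr_ge0// mulr_ge0 ?exprn_ge0.
have t0 : 0 < t by rewrite (lt_trans _ t1).
rewrite exponential_pdfE; last exact: ltW.
rewrite /rwgt t0.
have E : expR (- t) = expR (- 2^-1 * t) * expR (- (t / 2)).
  by rewrite -expRD; congr expR; field.
set K := 2 ^+ n.+1 * _.
have -> : 2 * K * (2^-1 * expR (- 2^-1 * t)) = K * expR (- 2^-1 * t) by field.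
rewrite E mulrCA (mulrC (expR (- 2^-1 * t))) ler_wpM2r ?expR_ge0//.
rewrite expRN ler_pdivrMr ?expR_gt0//.
have h1 : t `^ (a - 1) <= t ^+ n.+1.
  rewrite -powR_mulrn ?(ltW t0)// ler_powR ?(ltW t1)//.
  by rewrite (le_trans (ler_norm _))// ltW// truncnS_gt.
apply: (le_trans h1).
have := expR_ge1Dxn n (ltW (divr_gt0 t0 (ltr0n R 2))).
move=> /(le_trans (ler_wpDl ler01 (lexx _))) h2.
have -> : t ^+ n.+1 = K * ((t / 2) ^+ n.+1 / (n.+1)`!%:R).
  have f0 : ((n.+1)`!%:R : R) != 0 by rewrite pnatr_eq0 -lt0n fact_gt0.
  rewrite /K exprMn exprVn; field.
  by rewrite f0 ?expf_neq0 ?pnatr_eq0.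
by rewrite ler_wpM2l// /K mulr_ge0 ?exprn_ge0.
Qed.

Lemma eGamma_lty (a : R) : 0 < a -> (eGamma a < +oo)%E.
Proof.
move=> a0; have [M M0 HM] := rwgt_expRN_le a.
(* [f] dominates on [(0, 1]], where the exponential is at most [1], and [g] beyond [1]. The
   redundant [a^-1 * (a * _)] matches [integral_rwgt01]. *)
pose f (t : RT) := ((fun t : RT => (a^-1 * (a * rwgt a t))%:E) \_ `]0%R, 1%R]) t.
pose g (t : RT) := (M * exponential_pdf 2^-1 t)%:E.
have mf : measurable_fun setT f.
  apply/(measurable_restrictT _ _).1 => //.
  apply: measurable_funTS; apply/measurable_EFinP; apply: measurable_funM => //.
  by apply: measurable_funM => //; exact: measurable_rwgt.
have mg : measurable_fun setT g.
  apply/measurable_EFinP; apply: measurable_funM => //.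
  by apply: measurable_exponential_pdf; rewrite invr_ge0.
have g0 t : (0 <= g t)%E.
  by rewrite lee_fin mulr_ge0// exponential_pdf_ge0// invr_ge0.
have f0 t : (0 <= f t)%E.
  rewrite /f patchE; case: ifP => // _.
  by rewrite lee_fin !mulr_ge0 ?invr_ge0 ?rwgt_ge0 ?ltW.
apply: (@le_lt_trans _ _ (\int[leb]_t (f t + g t))%E).
  apply: ge0_le_integral => //.
  - by move=> t _; rewrite lee_fin mulr_ge0 ?rwgt_ge0 ?expR_ge0.
  - exact: measurable_gamma_integrand.
  - exact: emeasurable_funD.
  - move=> t _; have [t0|t0] := ltP 0 t; last first.
      by rewrite /rwgt ltNge t0 /= mul0r adde_ge0.
    have [t1|t1] := ltP 1 t.
      by rewrite (le_trans _ (leeDr _ (f0 t)))// lee_fin; exact: HM.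
    apply: (le_trans _ (leeDl _ (g0 t))); rewrite /f patchE mem_set; last first.
      by rewrite /= in_itv /= t0.
    rewrite lee_fin mulKf ?gt_eqF// ler_piMr ?rwgt_ge0//.
    by rewrite -expR0 ler_expR oppr_le0 ltW.
rewrite ge0_integralD//.
apply: lte_add_pinfty.
  rewrite -integral_mkcond.
  under eq_integral do rewrite EFinM.
  rewrite ge0_integralZl//.
  - rewrite lte_mul_pinfty ?lee_fin ?invr_ge0 ?(ltW a0)//.
    by apply: le_lt_trans (integral_rwgt01 a0) _; rewrite ltry.
  - apply: measurable_funTS; apply/measurable_EFinP.
    by apply: measurable_funM => //; exact: measurable_rwgt.
  - by move=> t _; rewrite lee_fin mulr_ge0 ?rwgt_ge0// ltW.
  - by rewrite lee_fin invr_ge0 ltW.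
rewrite /g; under eq_integral do rewrite EFinM.
rewrite ge0_integralZl//.
- by rewrite integral_exponential_pdf ?invr_gt0// mule1 ltry.
- by apply/measurable_EFinP; apply: measurable_exponential_pdf; rewrite invr_ge0.
- by move=> t _; rewrite lee_fin exponential_pdf_ge0// invr_ge0.
Qed.

Lemma eGamma1 : eGamma 1 = 1%E.
Proof.
rewrite -(@integral_exponential_pdf R 1 ltr01) /eGamma.
(* The integrands disagree at [0], where the exponential density is [1] and [rwgt 1] is [0], so this
   point is removed from both integrals. *)
have mD : measurable ([set: RT] `\ 0) by apply: measurableD.
have mp : measurable_fun ([set: RT] `\ 0) (fun t : RT => (exponential_pdf 1 t)%:E).
  by apply: measurable_funTS; apply/measurable_EFinP; exact: measurable_exponential_pdf.
have mg := measurable_funTS (D := [set: RT] `\ 0) (measurable_gamma_integrand 1).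
rewrite -(integral_setD1 mD mg) -(integral_setD1 mD mp).
apply: eq_integral => t; rewrite inE /= => -[_ /eqP t0]; congr EFin.
have [t1|] := ltP 0 t.
  by rewrite exponential_pdfE ?(ltW t1)// /rwgt t1 subrr powRr0 mulN1r.
rewrite le_eqVlt (negbTE t0) /= => t1.
by rewrite lt0_exponential_pdf// /rwgt ltNge (ltW t1) mul0r.
Qed.

Lemma eGamma_gt0 (a : R) : (0 < eGamma a)%E.
Proof.
(* A lower bound of the integrand on [[1, 2]]: there [0 <= ln t <= 2], so the power is at least
   [exp(-2 |a - 1|)], and [exp(-t) >= exp(-2)]. *)
pose m : R := expR (- (`|a - 1| * 2)) * expR (- 2).
have m0 : 0 < m by rewrite mulr_gt0 ?expR_gt0.
apply: (@lt_le_trans _ _ (\int[leb]_(t in `[1%R, 2%R]) (cst m%:E t))%E).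
  rewrite integral_cst// /= lebesgue_measure_itv /= lte_fin ltr1n /= -EFinD.
  by rewrite mule_gt0// lte_fin; lra.
rewrite integral_mkcond; apply: ge0_le_integral => //.
- by move=> t _; rewrite patchE; case: ifP => // _; rewrite lee_fin ltW.
- by apply/(measurable_restrictT _ _).1 => //; exact: measurable_cst.
- exact: measurable_gamma_integrand.
- move=> t _; rewrite patchE; case: ifPn => [|_]; last first.
    by rewrite lee_fin mulr_ge0 ?rwgt_ge0 ?expR_ge0.
  rewrite inE /= in_itv /= => /andP[t1 t2]; have t0 : 0 < t by rewrite (lt_le_trans _ t1).
  rewrite lee_fin /rwgt t0 /powR gt_eqF// ler_pM ?expR_ge0// ler_expR ?lerN2//.
  have l0 : 0 <= ln t by exact: ln_ge0.
  have l2 : ln t <= 2 by rewrite (le_trans (ltW (ln_sublinear t0))).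
  rewrite lerNl (le_trans (ler_norm _))// normrN normrM (ger0_norm l0).
  by rewrite ler_wpM2l.
Qed.

Definition rGamma (a : R) : R := fine (eGamma a).

Lemma EFin_rGamma (a : R) : 0 < a -> ((rGamma a)%:E = eGamma a)%E.
Proof.
by move=> a0; rewrite fineK// ge0_fin_numE ?eGamma_lty// ltW// eGamma_gt0.
Qed.

Lemma rGamma_gt0 (a : R) : 0 < a -> 0 < rGamma a.
Proof. by move=> a0; rewrite -lte_fin EFin_rGamma// eGamma_gt0. Qed.

(** In the convolution identity with [g r = exp(-r)], the factor [exp(-(u + v))] splits and the
    double integral becomes a product. *)
Lemma eBetaM (a b : R) : 0 < a -> 0 < b ->
  (eBeta a b * eGamma (a + b) = eGamma a * eGamma b)%E.
Proof.
move=> a0 b0.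
have mE : measurable_fun setT (fun t : RT => (expR (- t))%:E).
  by apply/measurable_EFinP; exact: measurable_expRN.
have E0 (t : R) : (0 <= (expR (- t))%:E)%E by rewrite lee_fin expR_ge0.
rewrite /eGamma; under eq_integral do rewrite EFinM.
rewrite -ge0_integral_rwgt_conv//.
rewrite -[X in (_ * X)%E]/(eGamma b) -(EFin_rGamma b0).
rewrite -(ge0_integralZr _ measurableT (measurable_gamma_integrand a)); last 2 first.
  by move=> t _; rewrite lee_fin mulr_ge0 ?rwgt_ge0 ?expR_ge0.
  by rewrite lee_fin ltW// rGamma_gt0.
apply: eq_integral => u _; rewrite (EFin_rGamma b0) /eGamma.
rewrite -(ge0_integralZl _ measurableT (measurable_gamma_integrand b)); last 2 first.
  by move=> t _; rewrite lee_fin mulr_ge0 ?rwgt_ge0 ?expR_ge0.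
  by rewrite lee_fin mulr_ge0 ?rwgt_ge0 ?expR_ge0.
apply: eq_integral => v _; rewrite -!EFinM; congr EFin.
by rewrite opprD expRD; ring.
Qed.

Definition rBeta (a b : R) : R := rGamma a * rGamma b / rGamma (a + b).

(** An infinite Beta integral would stay infinite after multiplication by the positive number
    [rGamma (a + b)], whereas the product in [eBetaM] is finite. *)
Lemma eBetaE (a b : R) : 0 < a -> 0 < b -> eBeta a b = (rBeta a b)%:E.
Proof.
move=> a0 b0; have ab0 := addr_gt0 a0 b0.
have G0 := rGamma_gt0 ab0.
have := eBetaM a0 b0; rewrite -!EFin_rGamma//.
have := eBeta_ge0 a b; case: (eBeta a b) => [r _|_|//].
  by rewrite -!EFinM => -[E]; rewrite /rBeta -E mulfK// gt_eqF.
by rewrite gt0_mulye ?lte_fin.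
Qed.

Lemma rBeta_gt0 (a b : R) : 0 < a -> 0 < b -> 0 < rBeta a b.
Proof. by move=> a0 b0; rewrite divr_gt0 ?mulr_gt0 ?rGamma_gt0 ?addr_gt0. Qed.

End real_gamma.

Section complex_gamma.
Context {R : realType}.
Local Notation leb := (@lebesgue_measure R).
Local Notation RT := (measurableTypeR R).
Implicit Types (s z : R[i]).

Lemma Re_cD s z : complex.Re (s + z) = complex.Re s + complex.Re z.
Proof. by case: s; case: z. Qed.

Definition cBeta s z : R[i] :=
  cintegral leb setT (fun t : RT => wgt s t * wgt z (1 - t)).

Lemma cmeasurable_wgtB s z (r : R) :
  cmeasurable (fun t : RT => wgt s t * wgt z (r - t)).
Proof.
apply: cmeasurableM; first exact: measurable_wgt.
by apply: measurable_wgt; apply: measurable_funB.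
Qed.

Lemma cintegrable_wgtB s z (r : R) : 0 < complex.Re s -> 0 < complex.Re z ->
  cintegrable leb setT (fun t : RT => wgt s t * wgt z (r - t)).
Proof.
move=> s0 z0; apply/(cintegrableP leb (cmeasurable_wgtB s z r)).
under eq_integral do rewrite ComplexField.Normc.normcM !normc_wgt.
by rewrite integral_rwgt_conv eBetaE// -EFinM ltry.
Qed.

Lemma cintegral_wgt_conv s z (r : R) : 0 < complex.Re s -> 0 < complex.Re z ->
  cintegral leb setT (fun t : RT => wgt s t * wgt z (r - t)) =
  wgt (s + z) r * cBeta s z.
Proof.
move=> s0 z0; have [r0|r0] := ltP 0 r; last first.
  rewrite [in RHS]/wgt ltNge r0 /= mul0r.
  rewrite (_ : (fun t : RT => _) = fun=> 0); last first.
    apply/funext => t; rewrite /wgt; case: ifPn => t0; last by rewrite mul0r.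
    by rewrite subr_gt0 ltNge (le_trans r0 (ltW t0)) mulr0.
  by rewrite /cintegral /= !Rintegral_cst// !mul0r.
have rV0 : 0 < r^-1 by rewrite invr_gt0.
have i1 := cintegrable_wgtB 1 s0 z0.
(* Replacing [t] by [t / r] in the Beta integral costs a factor [r]. The two powers of [r] are
   absorbed by the weights, which turns [1 - t / r] into [r - t]. *)
have /(cintegralM (cpow r (s - 1) * cpow r (z - 1))) :=
  cintegrable_affine 0 rV0 (cmeasurable_wgtB s z 1) i1.
rewrite (cintegral_affine 0 rV0 i1) -/(cBeta s z) invrK.
rewrite (_ : (fun x => _) = (fun t : RT => wgt s t * wgt z (r - t))); last first.
  apply/funext => t; rewrite addr0 mulrACA -!wgtM// mulrBr mulr1 !mulrA.
  by rewrite mulfV ?gt_eqF// mul1r.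
move=> ->; rewrite mulrA; congr (_ * _).
rewrite /wgt r0 -cpow1r// -!cpowD; congr (cpow _ _); ring.
Qed.

Section convolution.
Variables (s z : R[i]) (g : R -> R[i]).
Hypotheses (s0 : 0 < complex.Re s) (z0 : 0 < complex.Re z).
Hypothesis mg : cmeasurable (g : RT -> R[i]).

Lemma ge0_integral_wgt_conv :
  (\int[leb \x leb]_p (normc (wgt s p.1 * wgt z p.2 * g (p.1 + p.2)%R))%:E =
   (rBeta (complex.Re s) (complex.Re z))%:E *
   \int[leb]_r (normc (wgt (s + z) r * g r))%:E)%E.
Proof.
have mF : cmeasurable (fun p : RT * RT => wgt s p.1 * wgt z p.2 * g (p.1 + p.2)).
  apply: cmeasurableM; first by apply: cmeasurableM; exact: measurable_wgt.
  by apply: (cmeasurableT_comp mg); apply: measurable_funD.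
rewrite fubini_tonelli1; last 2 first.
- exact: emeasurable_normc.
- by move=> p; rewrite lee_fin normc_ge0.
rewrite -eBetaE//.
under [X in (_ * X)%E]eq_integral do
  rewrite ComplexField.Normc.normcM normc_wgt Re_cD EFinM.
rewrite -(@ge0_integral_rwgt_conv _ _ _ (fun r => (normc (g r))%:E)); last 2 first.
- exact: emeasurable_normc.
- by move=> r; rewrite lee_fin normc_ge0.
apply: eq_integral => u _; apply: eq_integral => v _.
by rewrite /= !ComplexField.Normc.normcM !normc_wgt EFinM.
Qed.

Hypothesis ig : cintegrable leb setT (fun r : RT => wgt (s + z) r * g r).

Let mF : cmeasurable (fun p : RT * RT => wgt s p.1 * wgt z p.2 * g (p.1 + p.2)).
Proof.
apply: cmeasurableM; first by apply: cmeasurableM; exact: measurable_wgt.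
by apply: (cmeasurableT_comp mg); apply: measurable_funD.
Qed.

Let mwg : cmeasurable (fun r : RT => wgt (s + z) r * g r).
Proof. by apply: cmeasurableM => //; exact: measurable_wgt. Qed.

Lemma cintegrable_wgt_conv : cintegrable (leb \x leb)%E setT
  (fun p : RT * RT => wgt s p.1 * wgt z p.2 * g (p.1 + p.2)).
Proof.
apply/(cintegrableP _ mF); rewrite ge0_integral_wgt_conv.
rewrite lte_mul_pinfty ?lee_fin ?ltW ?rBeta_gt0//.
exact: (cintegrableP leb mwg).1.
Qed.

Lemma cintegral_prod_wgt_conv : cintegral (leb \x leb)%E setT
    (fun p : RT * RT => wgt s p.1 * wgt z p.2 * g (p.1 + p.2)) =
  cBeta s z * cintegral leb setT (fun r : RT => wgt (s + z) r * g r).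
Proof.
rewrite (cintegral_prod1 cintegrable_wgt_conv).
pose h (p : RT * RT) := wgt s p.1 * wgt z (p.2 - p.1) * g p.2.
have mh : cmeasurable h.
  apply: cmeasurableM; last exact: (cmeasurableT_comp mg).
  apply: cmeasurableM; apply: measurable_wgt => //.
  by apply: measurable_funB.
have hF u v : h (u, v + u) = wgt s u * wgt z v * g (u + v).
  by rewrite /h /= addrK addrC.
(* Exchanging the integrals of [h] needs its absolute integrability. By Tonelli it follows from that
   of the original integrand, since at fixed [u] the inner integrals of the moduli differ by a
   translation. *)
have ih : cintegrable (leb \x leb)%E setT h.
  apply/(cintegrableP _ mh).
  have := (cintegrableP _ mF).1 cintegrable_wgt_conv.
  rewrite fubini_tonelli1; last 2 first.
  - exact: emeasurable_normc.
  - by move=> p; rewrite lee_fin normc_ge0.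
  rewrite fubini_tonelli1; last 2 first.
  - exact: emeasurable_normc.
  - by move=> p; rewrite lee_fin normc_ge0.
  have eq_lty (x y : \bar R) : x = y -> (x < +oo)%E -> (y < +oo)%E by move=> ->.
  apply: eq_lty; apply: eq_integral => u _.
  apply: etrans (ge0_integral_shift u (f := fun r => (normc (h (u, r)))%:E) _ _).
  - by apply: eq_integral => v _; rewrite hF.
  - apply: emeasurable_normc; apply: (cmeasurableT_comp mh).
    exact: measurable_pair1.
  - by move=> r; rewrite lee_fin normc_ge0.
transitivity (cintegral leb setT (fun u : RT => cintegral leb setT (fun r : RT => h (u, r)))).
  congr (cintegral _ _ _); apply/funext => u.
  rewrite -(@cintegral_shift R u (fun r => h (u, r))).
    by congr (cintegral _ _ _); apply/funext => v; rewrite hF.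
  by apply: (cmeasurableT_comp mh); exact: measurable_pair1.
rewrite -(cintegral_prod1 ih) (cintegral_prod2 ih).
rewrite -(cintegralM _ ig); congr (cintegral _ _ _); apply/funext => r.
rewrite /h /= mulrA (mulrC (cBeta _ _)) -cintegral_wgt_conv//.
rewrite [RHS]mulrC -(cintegralM (g r) (cintegrable_wgtB r s0 z0)).
by congr (cintegral _ _ _); apply/funext => u; rewrite mulrC.
Qed.

End convolution.

Lemma cGammaE z :
  cGamma z = cintegral leb setT (fun t : RT => wgt z t * (expR (- t))%:C).
Proof.
rewrite /cGamma cintegral_mkcond; congr (cintegral _ _ _); apply/funext => t.
have [t0|t0] := ltP 0 t.
  by rewrite mem_set /= ?in_itv /= ?t0// /wgt t0.
rewrite memNset /= ?in_itv /= ?ltNge ?t0//.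
by rewrite /wgt ltNge t0 mul0r.
Qed.

Lemma cGamma_real (a : R) : cGamma a%:C = (rGamma a)%:C.
Proof.
rewrite cGammaE /rGamma /eGamma -[fine _]/(\int[leb]_t (rwgt a t * expR (- t))).
rewrite -cintegral_real; congr (cintegral _ _ _); apply/funext => t.
by rewrite wgt_real rmorphM.
Qed.

Lemma cmeasurable_gamma_integrand z :
  cmeasurable (fun t : RT => wgt z t * (expR (- t))%:C).
Proof.
apply: cmeasurableM; first exact: measurable_wgt.
by apply: cmeasurable_real; exact: measurable_expRN.
Qed.

Lemma cintegrable_gamma_integrand z : 0 < complex.Re z ->
  cintegrable leb setT (fun t : RT => wgt z t * (expR (- t))%:C).
Proof.
move=> z0; apply/(cintegrableP leb (cmeasurable_gamma_integrand z)).
under eq_integral do rewrite ComplexField.Normc.normcM normc_wgt normc_real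
  (ger0_norm (expR_ge0 _)).
exact: eGamma_lty.
Qed.

Lemma cBetaM s z : 0 < complex.Re s -> 0 < complex.Re z ->
  cBeta s z * cGamma (s + z) = cGamma s * cGamma z.
Proof.
move=> s0 z0; have sz0 : 0 < complex.Re (s + z) by rewrite Re_cD addr_gt0.
have mE : cmeasurable ((fun t : RT => (expR (- t))%:C) : RT -> R[i]).
  by apply: cmeasurable_real; exact: measurable_expRN.
have iE := cintegrable_gamma_integrand sz0.
rewrite cGammaE -cintegral_prod_wgt_conv// cintegral_prod1; last first.
  exact: (cintegrable_wgt_conv s0 z0 mE iE).
rewrite mulrC [cGamma s]cGammaE -(cintegralM _ (cintegrable_gamma_integrand s0)).
congr (cintegral _ _ _); apply/funext => u.
rewrite [cGamma z]cGammaE mulrC -(cintegralM _ (cintegrable_gamma_integrand z0)).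
congr (cintegral _ _ _); apply/funext => v /=.
by rewrite opprD expRD rmorphM /= mulrACA.
Qed.

End complex_gamma.

(** * Nonvanishing of the Gamma function *)

Section gamma_nonvanishing.
Context {R : realType}.
Local Notation leb := (@lebesgue_measure R).
Local Notation RT := (measurableTypeR R).
Implicit Types (s z : R[i]).

Lemma sin_ler_norm (x : R) : `|sin x| <= `|x|.
Proof.
wlog x0 : x / 0 < x => [hw|].
  have [x0|x0|<-] := ltgtP 0 x; [exact: hw| |by rewrite sin0].
  by rewrite -normrN -sinN -(normrN x); apply: hw; rewrite oppr_gt0.
have cs : {within `[0, x], continuous (@sin R)}.
  by apply: continuous_subspaceT => y; exact: continuous_sin.
have [c _] := MVT x0 (fun y _ => is_derive_sin y) cs.
rewrite sin0 !subr0 => ->; rewrite normrM ler_piMl//; exact: cos_max.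
Qed.

(** Write [cos x = 1 - 2 sin(x / 2) ^ 2] and use [|sin y| <= |y|]. *)
Lemma cos_ge (x : R) : 1 - x ^+ 2 / 2 <= cos x.
Proof.
have -> : cos x = 1 - 2 * sin (x / 2) ^+ 2.
  have {1}-> : x = x / 2 + x / 2 by field.
  by rewrite cosD -!expr2 cos2sin2; ring.
rewrite lerD2l lerN2.
have : sin (x / 2) ^+ 2 <= (x / 2) ^+ 2.
  rewrite -(real_normK (num_real (sin _))) -(real_normK (num_real (x / 2))).
  by rewrite lerXn2r ?nnegrE// sin_ler_norm.
by have -> : x ^+ 2 / 2 = 2 * (x / 2) ^+ 2; [field|rewrite ler_pM2l].
Qed.

(** For [v = sqrt u], the inequality [ln x <= x - 1] at [v] and at [1 / v] bounds [(ln v) ^ 2] by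
    [(v - 1) ^ 2 + (1 / v - 1) ^ 2], and [v + 1 / v >= 2] bounds this by [u + 1 / u - 2]. The factor
    [4] is due to [ln u = 2 ln v]. A bound by [u], [1 / u] and constants is wanted because
    multiplying a Gamma density by [t] or [1 / t] gives another one. *)
Lemma ln_sqr_le (u : R) : 0 < u -> ln u ^+ 2 <= 4 * (u + u^-1 - 2).
Proof.
move=> u0; pose v := Num.sqrt u.
have v0 : 0 < v by rewrite sqrtr_gt0.
have uE : u = v ^+ 2 by rewrite sqr_sqrtr// ltW.
have ln_le (w : R) : 0 < w -> ln w <= w - 1.
  move=> w0; have := @le_ln1Dx R (w - 1).
  by rewrite addrCA subrr addr0; apply; lra.
have h1 := ln_le v v0.
have vi0 : 0 < v^-1 by rewrite invr_gt0.
have h2 := ln_le _ vi0; rewrite lnV ?posrE// in h2.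
have hv : v * v^-1 = 1 by rewrite mulfV// gt_eqF.
rewrite uE lnXn// -exprVn.
set l := ln v in h1 h2 *; set w := v^-1 in h2 hv vi0 *.
have vw : 2 <= v + w.
  have : 0 <= (v - w) ^+ 2 by exact: sqr_ge0.
  move=> h; rewrite leNgt; apply/negP => h'; nra.
have : l ^+ 2 <= (v - 1) ^+ 2 + (w - 1) ^+ 2.
  have [l0|l0] := leP 0 l.
    have : l ^+ 2 <= (v - 1) ^+ 2 by rewrite lerXn2r// ?nnegrE//; lra.
    by move=> h; have := sqr_ge0 (w - 1); lra.
  have : (- l) ^+ 2 <= (w - 1) ^+ 2 by rewrite lerXn2r// ?nnegrE//; lra.
  by rewrite sqrrN => h; have := sqr_ge0 (v - 1); lra.
rewrite -mulr_natr; nra.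
Qed.

Lemma ae_neq1 (f g : RT -> R[i]) (a : R) : (forall t, t != a -> f t = g t) ->
  {ae leb, forall t, f t = g t}.
Proof.
move=> fg; exists [set a]; split => //.
- exact: lebesgue_measure_set1.
- by move=> t /= h; apply: contrapT => /eqP ta; apply: h; exact: fg.
Qed.

(* With f t = t ^ (z - 1) on (0, 1), the function f t - 2 ^ (1 - z) f (2 t) is
   supported on [1/2, 1], which avoids integrating up to 0. *)
Lemma cBetaz1 z : 0 < complex.Re z -> z * cBeta z 1 = 1.
Proof.
move=> z0.
have q0 : (0 : R) < 2^-1 by rewrite invr_gt0.
have t0 : (0 : R) < 2 by [].
have q01 : 0 < (2^-1 : R) < 1.
  by apply/andP; split => //; lra.
have o1 : 0 < complex.Re (1 : R[i]) by [].
have i1 := cintegrable_wgtB 1 z0 o1; have m1 := @cmeasurable_wgtB R z 1 1.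
pose J := cBeta z 1.
have := cintegral_affine 0 t0 i1; rewrite -/(cBeta z 1) -/J => JE.
have i2 := cintegrable_affine 0 t0 m1 i1.
pose w := cpow 2 (1 - z).
pose f (t : RT) := wgt z t * wgt 1 (1 - t).
pose r (t : RT) : R[i] := if t \in `[2^-1, 1]%classic then z * cpow t (z - 1) else 0.
have mr : cmeasurable r.
  apply: cmeasurable_if; last exact: cmeasurable_cst.
    apply: (measurable_fun_bool true) => //.
    rewrite setTI (_ : _ @^-1` _ = `[2^-1, 1]%classic)//.
    by apply/seteqP; split => t /=; [move=> /set_mem|move=> ?; exact: mem_set].
  apply: cmeasurableM; [exact: cmeasurable_cst|exact: measurable_cpow].
have mf2 : cmeasurable (fun t : RT => f (2 * t + 0)).
  apply: (cmeasurableT_comp m1); apply: measurable_funD => //; exact: measurable_funM.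
have i3 : cintegrable leb setT (fun t : RT => - w * f (2 * t + 0)).
  exact: cintegrableM.
have i13 := cintegrableD i1 i3.
have := cintegralM z i13.
rewrite (cintegralD i1 i3) (cintegralM _ i2) JE -/J.
rewrite (@ae_eq_cintegral _ _ _ leb _ r)//; last 2 first.
- apply: cmeasurableM; first exact: cmeasurable_cst.
  by apply: cmeasurableD => //; apply: cmeasurableM => //; exact: cmeasurable_cst.
(* At [t = 1] the cut-off [wgt 1 (1 - t)] vanishes while [r] does not, so the functions agree only
   almost everywhere. *)
- apply: (@ae_neq1 _ _ 1) => t t1; rewrite /r /f addr0.
  have W1 (c : R) : wgt 1 c = if 0 < c then 1 else 0.
    by rewrite /wgt subrr cpow0.
  rewrite !W1 !subr_gt0 wgtM//.
  have [tle|tgt] := leP t 0.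
    rewrite memNset; last first.
      by rewrite /= in_itv /= => /andP[h _]; have := lt_le_trans q0 h; rewrite ltNge tle.
    by rewrite /wgt ltNge tle /= mulr0 !mul0r mulr0 addr0 mulr0.
  have [tq|tq] := ltP t 2^-1.
    have tl1 : t < 1 by apply: lt_trans tq _; case/andP: q01.
    have -> : 2 * t < 1 by rewrite mulrC -ltr_pdivlMr// mul1r.
    rewrite tl1 memNset; last by rewrite /= in_itv /= leNgt tq.
    rewrite !mulr1 mulrA mulNr /w -cpowD.
    by rewrite addrA subrK subrr cpow0 mulN1r subrr mulr0.
  have -> : (2 * t < 1) = false.
    by apply/negbTE; rewrite -leNgt mulrC -ler_pdivrMr// mul1r.
  rewrite !mulr0 addr0.
  have [tl1|tl1] := ltP t 1.
    by rewrite mem_set /= ?in_itv /= ?tq ?(ltW tl1)// mulr1 /wgt tgt.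
  rewrite mulr0 mulr0 memNset//= in_itv /= => /andP[_ t1'].
  by move: t1; rewrite eq_le t1' tl1.
rewrite -cintegral_mkcond (integral_cpow z q01) => E.
pose Q := cpow 2^-1 z.
have QE : w * (2^-1)%:C = Q.
  rewrite /w -cpow1r// /Q {1}/cpow -/(cpow _ _) -[cpow 2^-1 1]/(cexp _) -cexpD /cpow.
  by rewrite lnV ?posrE// rmorphN /=; congr cexp; ring.
(* The dilation yields [1 - Q = z J (1 - Q)] with [Q = 2 ^ (-z)]. The common factor can be cancelled
   because [|Q| < 1], which is where [Re z > 0] matters. *)
have Q1 : 1 - Q != 0.
  rewrite subr_eq0; apply/eqP => /(congr1 (@ComplexField.Normc.normc R)).
  rewrite ComplexField.Normc.normc1 => Q1.
  have : ComplexField.Normc.normc Q < 1.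
    by rewrite /Q normc_cpow// /powR gt_eqF// expR_lt1 pmulr_rlt0// ln_lt0.
  by rewrite -Q1 ltxx.
have E2 : 1 - Q = z * (J + - w * ((2^-1)%:C * J)) by exact: E.
by apply: (mulIf Q1); rewrite mul1r [RHS]E2 -QE -/J; ring.
Qed.

(** Multiply [Beta(z, 1) Gamma(z + 1) = Gamma(z) Gamma(1)] by [z]; this avoids integrating by parts
    on an unbounded interval. *)
Lemma cGammaS z : 0 < complex.Re z -> cGamma (z + 1) = z * cGamma z.
Proof.
move=> z0; have o1 : 0 < complex.Re (1 : R[i]) by [].
have G1 : cGamma (1 : R[i]) = 1.
  by rewrite -[1 in LHS]/(1%:C) cGamma_real /rGamma eGamma1.
by have := cBetaM z0 o1; rewrite G1 mulr1 => <-; rewrite mulrA cBetaz1// mul1r.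
Qed.

Lemma rGammaS (a : R) : 0 < a -> rGamma (a + 1) = a * rGamma a.
Proof.
move=> a0; apply: (@complexI R); rewrite rmorphM /= -!cGamma_real -cGammaS//.
by rewrite rmorphD.
Qed.

Definition gamma_density (a : R) (t : RT) : R := rwgt a t * expR (- t).

Lemma gamma_density_ge0 (a : R) t : 0 <= gamma_density a t.
Proof. by rewrite mulr_ge0 ?rwgt_ge0 ?expR_ge0. Qed.

Lemma integrable_gamma_density (a c : R) : 0 < a ->
  leb.-integrable setT (EFin \o (fun t => c * gamma_density a t)).
Proof.
move=> a0; apply: (@eq_integrable _ _ _ leb _ measurableT
  (fun t => c%:E * (gamma_density a t)%:E)%E) => //.
apply: integrableZl => //; apply/integrableP; split.
  exact: measurable_gamma_integrand.
under eq_integral do rewrite gee0_abs ?lee_fin ?gamma_density_ge0//.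
exact: eGamma_lty.
Qed.

Lemma Rintegral_gamma_density (a c : R) : 0 < a ->
  \int[leb]_t (c * gamma_density a t) = c * rGamma a.
Proof.
move=> a0; have := integrable_gamma_density 1 a0.
rewrite (_ : EFin \o _ = EFin \o gamma_density a); last first.
  by apply/funext => t; rewrite /= mul1r.
by move=> /RintegralZl -> //.
Qed.

(* After rotation by x ^ (- i y), where z = x + i y, the real part of the
   integrand is the Gamma density times cos (y ln (t / x)). The bounds
   cos v >= 1 - v ^ 2 / 2 and ln u ^ 2 <= 4 (u + 1 / u - 2) reduce its integral
   to values of the real Gamma function at x - 1, x and x + 1. *)
Lemma cGamma_neq0_large z :
  1 + 2 * complex.Im z ^+ 2 < complex.Re z -> cGamma z != 0.
Proof.
set x := complex.Re z; set y := complex.Im z => xy.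
have y2 : 0 <= y ^+ 2 by exact: sqr_ge0.
have x1 : 0 < x - 1 by lra.
have x0 : 0 < x by lra.
have xp : 0 < x + 1 by lra.
apply/eqP => G0.
pose u (t : RT) := gamma_density x t * cos (y * (ln t - ln x)).
have iz := cintegrable_gamma_integrand x0.
have : complex.Re (cintegral leb setT (fun t : RT => cpow x (0 +i* (- y)) *
    (wgt z t * (expR (- t))%:C))) = 0.
  by rewrite (cintegralM _ iz) -cGammaE G0 mulr0.
rewrite {1}/cintegral [complex.Re _]/=.
have -> : (fun t : RT => complex.Re (cpow x (0 +i* (- y)) * (wgt z t * (expR (- t))%:C))) = u.
  apply/funext => t; rewrite /u /gamma_density /wgt /rwgt.
  case: ifPn => t0; last by rewrite !mul0r mulr0.
  have zE : z - 1 = (x - 1) +i* y by rewrite /x /y; case: (z) => a b; apply/eqP; rewrite eq_complex /= ?subr0 ?oppr0 ?addr0 !eqxx.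
  rewrite mulrA zE /cpow -cexpD /cexp /=.
  rewrite !(mulr0, mul0r, subr0, add0r, addr0, sub0r, oppr0).
  rewrite /powR gt_eqF// mulrBr (addrC _ (y * ln t)) mulNr.
  ring.
move=> u0.
(* With [r = t / x], the two bounds give [cos >= 1 - 2 y ^ 2 (r + 1 / r - 2) = 1 + 4 y ^ 2 - 2 y ^ 2
   r - 2 y ^ 2 / r]. Times the density of parameter [x], the terms in [t] and [1 / t] become
   densities of parameters [x + 1] and [x - 1]. *)
pose v (t : RT) := (1 + 4 * y ^+ 2) * gamma_density x t -
  ((2 * y ^+ 2 / x) * gamma_density (x + 1) t + (2 * y ^+ 2 * x) * gamma_density (x - 1) t).
have vu t : v t <= u t.
  have [t0|t0] := ltP 0 t; last first.
    by rewrite /v /u /gamma_density /rwgt ltNge t0 /= !mul0r !mulr0 addr0 subr0.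
  have tn : t != 0 by rewrite gt_eqF.
  have xn : x != 0 by rewrite gt_eqF.
  have rD a b : t `^ (a + b) = t `^ a * t `^ b by rewrite powRD// tn implybT.
  have Ep : gamma_density (x + 1) t = t * gamma_density x t.
    rewrite /gamma_density /rwgt t0 mulrA; congr (_ * _).
    by rewrite -{2}[t]powRr1 ?(ltW t0)// -rD; congr (_ `^ _); ring.
  have Em : gamma_density (x - 1) t = t^-1 * gamma_density x t.
    rewrite /gamma_density /rwgt t0 mulrA; congr (_ * _).
    by rewrite -(powR_inv1 (ltW t0)) -rD; congr (_ `^ _); ring.
  rewrite /v /u Ep Em.
  have -> : (1 + 4 * y ^+ 2) * gamma_density x t - (2 * y ^+ 2 / x * (t * gamma_density x t) +
      2 * y ^+ 2 * x * (t^-1 * gamma_density x t)) =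
      gamma_density x t * (1 - y ^+ 2 * (4 * (t / x + (t / x)^-1 - 2)) / 2).
    by field; rewrite tn xn.
  rewrite ler_wpM2l ?gamma_density_ge0//; apply: le_trans (cos_ge _).
  rewrite lerD2l lerN2 ler_pM2r ?invr_gt0// exprMn -ln_div ?posrE//.
  by rewrite ler_wpM2l// ln_sqr_le// divr_gt0.
have iv1 := integrable_gamma_density (1 + 4 * y ^+ 2) x0.
have iv2 := integrable_gamma_density (2 * y ^+ 2 / x) xp.
have iv3 := integrable_gamma_density (2 * y ^+ 2 * x) x1.
have iv23 := integrableD measurableT iv2 iv3.
have iv := integrableB measurableT iv1 iv23.
have mu_ : measurable_fun setT u.
  apply: measurable_funM.
    by apply/measurable_EFinP; exact: measurable_gamma_integrand.
  apply: (measurableT_comp (continuous_measurable_fun _)) => //.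
    exact: continuous_cos.
  by apply: measurable_funM => //; apply: measurable_funB => //; exact: measurable_ln.
have iu : leb.-integrable setT (EFin \o u).
  apply: (le_integrable measurableT _ _ (integrable_gamma_density 1 x0)).
    exact/measurable_EFinP.
  move=> t _; rewrite lee_fin mul1r normrM ler_piMr ?cos_max//.
have : \int[leb]_t v t <= 0.
  by rewrite -u0; apply: le_Rintegral.
rewrite /v RintegralB// RintegralD// !Rintegral_gamma_density//.
(* In terms of [Gamma(x - 1)], the integral of [v] is [(x - 1 - 2 y ^ 2) Gamma(x - 1)], positive
   exactly under the hypothesis on [z]; this explains the threshold. *)
have E1 : rGamma x = (x - 1) * rGamma (x - 1) by rewrite -rGammaS ?subrK.
have G0' := rGamma_gt0 x1.
rewrite (rGammaS x0) E1.
have -> : 2 * y ^+ 2 / x * (x * ((x - 1) * rGamma (x - 1))) =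
    2 * y ^+ 2 * ((x - 1) * rGamma (x - 1)) by field; rewrite gt_eqF.
nra.
Qed.

(** Each use of [Gamma(z + 1) = z Gamma(z)] raises the real part by [1] and leaves the threshold, a
    function of [Im z], unchanged. The induction is on the number [m] of shifts needed to pass
    it. *)
Lemma cGamma_neq0 z : 0 < complex.Re z -> cGamma z != 0.
Proof.
move=> z0.
suff H (m : nat) : forall z, 0 < complex.Re z ->
    1 + 2 * complex.Im z ^+ 2 < complex.Re z + m%:R -> cGamma z != 0.
  by apply: (H (Num.truncn (1 + 2 * complex.Im z ^+ 2)).+1 z z0);
    rewrite (lt_le_trans (truncnS_gt _))// lerDr ltW.
elim: m => [|m IH] {z0}z z0 h.
  by apply: cGamma_neq0_large; rewrite addr0 in h.
have : cGamma (z + 1) != 0.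
  have ImE : complex.Im (z + 1) = complex.Im z by case: (z) => a b /=; rewrite addr0.
  by apply: IH; rewrite ?ImE Re_cD /= ?addr_gt0// -addrA nat1r.
by rewrite cGammaS// mulf_eq0 negb_or => /andP[].
Qed.

End gamma_nonvanishing.

(** * Images of weighted measures on the line *)

Section radial_equivalence.
Context {R : realType}.
Local Notation leb := (@lebesgue_measure R).
Local Notation RT := (measurableTypeR R).

Lemma lty_pmull (c0 : R) (I : \bar R) : 0 < c0 -> (0 <= I)%E ->
  (c0%:E * I < +oo)%E -> (I < +oo)%E.
Proof.
move=> c00; case: I => [r _ _|_|//]; first by rewrite ltry.
by rewrite gt0_muley ?lte_fin.
Qed.

(** Test functions instead of sets allow the relation to be applied inside an iterated integral,
    with the other variable fixed. *)
Definition ge0_rel d1 d2 (T1 : measurableType d1) (T2 : measurableType d2)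
    (m1 : {measure set T1 -> \bar R}) (w1 q1 : T1 -> R)
    (m2 : {measure set T2 -> \bar R}) (w2 q2 : T2 -> R) (c : R) :=
  forall g : RT -> \bar R, measurable_fun setT g -> (forall r, 0 <= g r)%E ->
  (\int[m1]_x ((w1 x)%:E * g (q1 x)) = c%:E * \int[m2]_x ((w2 x)%:E * g (q2 x)))%E.

(* The images under q1 and q2 of the complex measures w1.m1 and w2.m2 are
   proportional with ratio c. The proportionality of the weights in absolute
   value is what transfers integrability. *)
Definition image_rel d1 d2 (T1 : measurableType d1) (T2 : measurableType d2)
    (m1 : {measure set T1 -> \bar R}) (w1 : T1 -> R[i]) (q1 : T1 -> R)
    (m2 : {measure set T2 -> \bar R}) (w2 : T2 -> R[i]) (q2 : T2 -> R) (c : R[i]) :=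
  (exists2 c0, 0 < c0 &
    ge0_rel m1 (fun x => normc (w1 x)) q1 m2 (fun x => normc (w2 x)) q2 c0) /\
  forall g : RT -> R[i], cmeasurable g ->
    cintegrable m1 setT (fun x => w1 x * g (q1 x)) ->
    cintegral m1 setT (fun x => w1 x * g (q1 x)) =
    c * cintegral m2 setT (fun x => w2 x * g (q2 x)).

Section rel_theory.
Context d1 d2 d3 (T1 : measurableType d1) (T2 : measurableType d2)
  (T3 : measurableType d3).
Variables (m1 : {measure set T1 -> \bar R}) (w1 : T1 -> R[i]) (q1 : T1 -> R).
Variables (m2 : {measure set T2 -> \bar R}) (w2 : T2 -> R[i]) (q2 : T2 -> R).
Variables (m3 : {measure set T3 -> \bar R}) (w3 : T3 -> R[i]) (q3 : T3 -> R).
Hypotheses (mw1 : cmeasurable w1) (mq1 : measurable_fun setT q1).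
Hypotheses (mw2 : cmeasurable w2) (mq2 : measurable_fun setT q2).

Lemma rel_integral_normc (g : RT -> R[i]) c0 : cmeasurable g ->
  ge0_rel m1 (fun x => normc (w1 x)) q1 m2 (fun x => normc (w2 x)) q2 c0 ->
  (\int[m1]_x (normc (w1 x * g (q1 x)))%:E =
   c0%:E * \int[m2]_x (normc (w2 x * g (q2 x)))%:E)%E.
Proof.
move=> mg H; under eq_integral do rewrite ComplexField.Normc.normcM EFinM.
under [X in (_ * X)%E]eq_integral do rewrite ComplexField.Normc.normcM EFinM.
apply: (H (fun r => (normc (g r))%:E)); first exact: emeasurable_normc.
by move=> r; rewrite lee_fin normc_ge0.
Qed.

(** The integrals of the moduli differ by the factor [c0], which is finite and nonzero, so
    finiteness passes both ways. *)
Lemma rel_cintegrable (c : R[i]) (g : RT -> R[i]) : cmeasurable g ->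
  image_rel m1 w1 q1 m2 w2 q2 c ->
  cintegrable m1 setT (fun x => w1 x * g (q1 x)) <->
  cintegrable m2 setT (fun x => w2 x * g (q2 x)).
Proof.
move=> mg [[c0 c00 H] _].
have mf1 : cmeasurable (fun x => w1 x * g (q1 x)).
  by apply: cmeasurableM => //; exact: cmeasurableT_comp mg mq1.
have mf2 : cmeasurable (fun x => w2 x * g (q2 x)).
  by apply: cmeasurableM => //; exact: cmeasurableT_comp mg mq2.
rewrite (cintegrableP m1 mf1) (cintegrableP m2 mf2) (rel_integral_normc mg H).
split => [|h]; last by rewrite lte_mul_pinfty ?lee_fin ?(ltW c00).
apply: lty_pmull => //; apply: integral_ge0 => x _.
by rewrite lee_fin normc_ge0.
Qed.

Lemma rel_trans (c e : R[i]) : image_rel m1 w1 q1 m2 w2 q2 c ->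
  image_rel m2 w2 q2 m3 w3 q3 e -> image_rel m1 w1 q1 m3 w3 q3 (c * e).
Proof.
move=> r12 [[e0 e00 H2] K2]; have [[c0 c00 H1] K1] := r12; split.
  by exists (c0 * e0) => [|g mg g0]; [exact: mulr_gt0|rewrite H1// H2// EFinM muleA].
move=> g mg ig; rewrite K1// K2 ?mulrA//.
exact/(rel_cintegrable mg r12).
Qed.

Lemma rel_trans1 (e : R[i]) : image_rel m1 w1 q1 m2 w2 q2 1 ->
  image_rel m2 w2 q2 m3 w3 q3 e -> image_rel m1 w1 q1 m3 w3 q3 e.
Proof. by move=> r12 r23; have := rel_trans r12 r23; rewrite mul1r. Qed.

(** A factor that depends on the point only through [q1] or [q2] can be moved into the test
    function. *)
Lemma rel_weight (c : R[i]) (u : RT -> R[i]) : cmeasurable u ->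
  image_rel m1 w1 q1 m2 w2 q2 c ->
  image_rel m1 (fun x => w1 x * u (q1 x)) q1 m2 (fun x => w2 x * u (q2 x)) q2 c.
Proof.
move=> mu [[c0 c00 H] K]; split.
  exists c0 => // g mg g0.
  under eq_integral do rewrite ComplexField.Normc.normcM EFinM -muleA.
  under [X in (_ * X)%E]eq_integral do rewrite ComplexField.Normc.normcM EFinM -muleA.
  apply: (H (fun r => (normc (u r))%:E * g r)%E).
    by apply: emeasurable_funM => //; exact: emeasurable_normc.
  by move=> r; rewrite mule_ge0// lee_fin normc_ge0.
move=> g mg ig.
have E d (T : measurableType d) (w : T -> R[i]) (q : T -> R) :
  (fun x => w x * u (q x) * g (q x)) = (fun x => w x * (u (q x) * g (q x))).
  by apply/funext => x; rewrite mulrA.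
rewrite !E; apply: (K (fun r => u r * g r)); first exact: cmeasurableM.
by move: ig; rewrite E.
Qed.

Lemma eq_rel w1' q1' w2' q2' (c : R[i]) : w1 =1 w1' -> q1 =1 q1' ->
  w2 =1 w2' -> q2 =1 q2' ->
  image_rel m1 w1 q1 m2 w2 q2 c -> image_rel m1 w1' q1' m2 w2' q2' c.
Proof.
by move=> /funext <- /funext <- /funext <- /funext <-.
Qed.

End rel_theory.

Lemma rel_image d1 d2 (T1 : measurableType d1) (T2 : measurableType d2)
    (m1 : {measure set T1 -> \bar R}) (m2 : {measure set T2 -> \bar R})
    (phi : T1 -> T2) (w : T2 -> R[i]) (q : T2 -> R) :
  measurable_fun setT phi ->
  (forall A, measurable A -> m2 A = m1 (phi @^-1` A)) ->
  cmeasurable w -> measurable_fun setT q ->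
  image_rel m1 (fun x => w (phi x)) (fun x => q (phi x)) m2 w q 1.
Proof.
move=> mphi mE mw mq; split.
  exists 1 => // g mg g0; rewrite mul1e.
  rewrite (ge0_integral_image mphi mE)//.
    by apply: emeasurable_funM; [exact: emeasurable_normc|exact: measurableT_comp].
  by move=> x; rewrite mule_ge0// lee_fin normc_ge0.
move=> g mg ig; rewrite mul1r (cintegral_image mphi mE)//.
by apply: cmeasurableM => //; exact: cmeasurableT_comp mg mq.
Qed.

Lemma rel_image_sym d1 d2 (T1 : measurableType d1) (T2 : measurableType d2)
    (m1 : {measure set T1 -> \bar R}) (m2 : {measure set T2 -> \bar R})
    (phi : T1 -> T2) (w : T2 -> R[i]) (q : T2 -> R) :
  measurable_fun setT phi ->
  (forall A, measurable A -> m2 A = m1 (phi @^-1` A)) ->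
  cmeasurable w -> measurable_fun setT q ->
  image_rel m2 w q m1 (fun x => w (phi x)) (fun x => q (phi x)) 1.
Proof.
move=> mphi mE mw mq; split.
  exists 1 => // g mg g0; rewrite mul1e.
  rewrite (ge0_integral_image mphi mE)//.
    by apply: emeasurable_funM; [exact: emeasurable_normc|exact: measurableT_comp].
  by move=> x; rewrite mule_ge0// lee_fin normc_ge0.
move=> g mg ig; rewrite mul1r (cintegral_image mphi mE)//.
by apply: cmeasurableM => //; exact: cmeasurableT_comp mg mq.
Qed.

Section rel_product.
Context d1 d1' d2 (T1 : measurableType d1) (T1' : measurableType d1')
  (T2 : measurableType d2).
Variables (m1 : {sigma_finite_measure set T1 -> \bar R}) (w1 : T1 -> R[i]) (q1 : T1 -> R).
Variables (m1' : {sigma_finite_measure set T1' -> \bar R}) (w1' : T1' -> R[i]) (q1' : T1' -> R).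
Variables (m2 : {sigma_finite_measure set T2 -> \bar R}) (w2 : T2 -> R[i]) (q2 : T2 -> R).
Hypotheses (mw1 : cmeasurable w1) (mq1 : measurable_fun setT q1).
Hypotheses (mw1' : cmeasurable w1') (mq1' : measurable_fun setT q1').
Hypotheses (mw2 : cmeasurable w2) (mq2 : measurable_fun setT q2).

(** At fixed second component [y], the function [w2 y * g (r + q2 y)] of [r] is itself a test
    function for the first factor. *)
Lemma rel_left (c : R[i]) : image_rel m1 w1 q1 m1' w1' q1' c ->
  image_rel (m1 \x m2)%E (fun p => w1 p.1 * w2 p.2) (fun p => q1 p.1 + q2 p.2)
      (m1' \x m2)%E (fun p => w1' p.1 * w2 p.2) (fun p => q1' p.1 + q2 p.2) c.
Proof.
have mW d (T : measurableType d) (w : T -> R[i]) : cmeasurable w ->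
    cmeasurable (fun p : T * T2 => w p.1 * w2 p.2).
  by move=> mw; apply: cmeasurableM; apply: cmeasurableT_comp.
have mQ d (T : measurableType d) (q : T -> R) : measurable_fun setT q ->
    measurable_fun setT (fun p : T * T2 => q p.1 + q2 p.2).
  by move=> mq; apply: measurable_funD; apply: measurableT_comp.
move=> [[c0 c00 H] K].
have P : ge0_rel (m1 \x m2)%E (fun p => normc (w1 p.1 * w2 p.2)) (fun p => q1 p.1 + q2 p.2)
      (m1' \x m2)%E (fun p => normc (w1' p.1 * w2 p.2)) (fun p => q1' p.1 + q2 p.2) c0.
  move=> g mg g0.
  have mF d (T : measurableType d) (w : T -> R[i]) (q : T -> R) :
      cmeasurable w -> measurable_fun setT q ->
      measurable_fun setT (fun p : T * T2 => (normc (w p.1 * w2 p.2))%:E * g (q p.1 + q2 p.2)%R)%E.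
    move=> mw mq; apply: emeasurable_funM; first exact/emeasurable_normc/mW.
    exact: measurableT_comp mg (mQ _ _ _ mq).
  have F0 d (T : measurableType d) (w : T -> R[i]) (q : T -> R) (p : T * T2) :
      (0 <= (normc (w p.1 * w2 p.2))%:E * g (q p.1 + q2 p.2)%R)%E.
    by rewrite mule_ge0// lee_fin normc_ge0.
  rewrite (fubini_tonelli2 _ (mF _ _ _ _ mw1 mq1) (F0 _ _ _ _)).
  rewrite (fubini_tonelli2 _ (mF _ _ _ _ mw1' mq1') (F0 _ _ _ _)).
  have m' := measurable_fun_fubini_tonelli_G (m1 := m1') _ (mF _ _ _ _ mw1' mq1') (F0 _ _ _ _).
  rewrite -(ge0_integralZl _ measurableT m'); last 2 first.
    by move=> y _; apply: integral_ge0 => x _; exact: F0.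
    by rewrite lee_fin ltW.
  apply: eq_integral => y _; rewrite /fubini_G /=.
  under eq_integral do rewrite ComplexField.Normc.normcM EFinM -muleA.
  under [X in (_ * X)%E]eq_integral do rewrite ComplexField.Normc.normcM EFinM -muleA.
  apply: (H (fun r => (normc (w2 y))%:E * g (r + q2 y)%R)%E).
    apply: emeasurable_funM => //; apply: (measurableT_comp mg).
    exact: measurable_funD.
  by move=> r; rewrite mule_ge0// lee_fin normc_ge0.
split; first by exists c0.
move=> g mg ig.
have mF d (T : measurableType d) (w : T -> R[i]) (q : T -> R) :
    cmeasurable w -> measurable_fun setT q ->
    cmeasurable (fun p : T * T2 => w p.1 * w2 p.2 * g (q p.1 + q2 p.2)).
  move=> mw mq; apply: cmeasurableM; first exact: mW.
  exact: cmeasurableT_comp mg (mQ _ _ _ mq).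
have ig' : cintegrable (m1' \x m2)%E setT
    (fun p => w1' p.1 * w2 p.2 * g (q1' p.1 + q2 p.2)).
  apply/(cintegrableP _ (mF _ _ _ _ mw1' mq1')).
  have := (cintegrableP _ (mF _ _ _ _ mw1 mq1)).1 ig.
  rewrite (rel_integral_normc (w1 := fun p : T1 * T2 => w1 p.1 * w2 p.2) mg P).
  apply: lty_pmull => //; apply: integral_ge0 => x _.
  by rewrite lee_fin normc_ge0.
rewrite (cintegral_prod2 ig) -(cintegralM _ ig').
rewrite (cintegral_prod2 (cintegrableM c ig')).
(* The hypothesis on complex test functions requires integrable sections, which Fubini provides only
   for almost every [y]. *)
apply: ae_eq_cintegral.
- exact: (cmeasurable_cintegral2 ig).
- exact: (cmeasurable_cintegral2 (cintegrableM c ig')).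
- apply: filterS2 (ae_cintegrable2 ig) (ae_cintegrable2 ig') => y iy iy' /=.
  rewrite (cintegralM _ iy').
  have E d (T : measurableType d) (w : T -> R[i]) (q : T -> R) :
    (fun x => w x * w2 y * g (q x + q2 y)) = (fun x => w x * (w2 y * g (q x + q2 y))).
    by apply/funext => x; rewrite mulrA.
  rewrite /= !E; apply: (K (fun r => w2 y * g (r + q2 y))).
    apply: cmeasurableM; first exact: cmeasurable_cst.
    by apply: (cmeasurableT_comp mg); exact: measurable_funD.
  by move: iy; rewrite /= E.
Qed.

End rel_product.

End radial_equivalence.

Section radial_measures.
Context {R : realType}.
Local Notation leb := (@lebesgue_measure R).
Local Notation RT := (measurableTypeR R).

(** [rel_left] replaces the first factor of a product only; the exchange makes it applicable to the
    second. *)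
Lemma rel_swap d1 d2 (T1 : measurableType d1) (T2 : measurableType d2)
    (m1 : {sigma_finite_measure set T1 -> \bar R}) (w1 : T1 -> R[i]) (q1 : T1 -> R)
    (m2 : {sigma_finite_measure set T2 -> \bar R}) (w2 : T2 -> R[i]) (q2 : T2 -> R) :
  cmeasurable w1 -> measurable_fun setT q1 ->
  cmeasurable w2 -> measurable_fun setT q2 ->
  image_rel (m1 \x m2)%E (fun p => w1 p.1 * w2 p.2) (fun p => q1 p.1 + q2 p.2)
      (m2 \x m1)%E (fun p => w2 p.1 * w1 p.2) (fun p => q2 p.1 + q1 p.2) 1.
Proof.
move=> mw1 mq1 mw2 mq2.
apply: (@eq_rel _ _ _ _ _ _ (fun p : T1 * T2 => w2 p.2 * w1 p.1)
  (fun p : T1 * T2 => q2 p.2 + q1 p.1) _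
  (fun p : T2 * T1 => w2 p.1 * w1 p.2) (fun p : T2 * T1 => q2 p.1 + q1 p.2)) => //.
- by move=> p; rewrite mulrC.
- by move=> p; rewrite addrC.
have msw : measurable_fun setT (fun p : T1 * T2 => (p.2, p.1)).
  exact: measurable_fun_pair.
apply: (@rel_image _ _ _ _ _ _ _ (fun p : T1 * T2 => (p.2, p.1))
  (fun p : T2 * T1 => w2 p.1 * w1 p.2) (fun p : T2 * T1 => q2 p.1 + q1 p.2)) => //.
- move=> A mA; transitivity (pushforward (m1 \x m2)%E (fun p : T1 * T2 => (p.2, p.1)) A) => //.
  apply: product_measure_unique => // B C mB mC.
  transitivity ((m1 \x m2)%E (C `*` B)); last by rewrite product_measure1E// muleC.
  rewrite /pushforward; congr ((m1 \x m2)%E _).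
  by apply/seteqP; split => -[x y] [].
- by apply: cmeasurableM; apply: cmeasurableT_comp.
- by apply: measurable_funD; apply: measurableT_comp.
Qed.

Lemma rel_wgt_conv (s t : R[i]) : 0 < complex.Re s -> 0 < complex.Re t ->
  image_rel (leb \x leb)%E (fun p : RT * RT => wgt s p.1 * wgt t p.2) (fun p => p.1 + p.2)
      leb (wgt (s + t)) idfun (cBeta s t).
Proof.
move=> s0 t0; split.
  exists (rBeta (complex.Re s) (complex.Re t)) => [|g mg g0]; first exact: rBeta_gt0.
  rewrite fubini_tonelli1; last 2 first.
  - apply: emeasurable_funM.
      by apply: emeasurable_normc; apply: cmeasurableM; exact: measurable_wgt.
    by apply: (measurableT_comp mg); exact: measurable_funD.
  - by move=> p; rewrite mule_ge0// lee_fin normc_ge0.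
  rewrite -eBetaE//; under [X in (_ * X)%E]eq_integral do rewrite normc_wgt Re_cD.
  rewrite -(ge0_integral_rwgt_conv _ _ mg g0).
  apply: eq_integral => u _; apply: eq_integral => v _.
  by rewrite /= ComplexField.Normc.normcM !normc_wgt.
move=> g mg ig; apply: cintegral_prod_wgt_conv => //.
have mwst : cmeasurable (fun r : RT => wgt (s + t) r * g r).
  by apply: cmeasurableM => //; exact: measurable_wgt.
apply/(cintegrableP leb mwst).
have mF : cmeasurable (fun p : RT * RT => wgt s p.1 * wgt t p.2 * g (p.1 + p.2)).
  apply: cmeasurableM; first by apply: cmeasurableM; exact: measurable_wgt.
  by apply: (cmeasurableT_comp mg); apply: measurable_funD.
have := (cintegrableP _ mF).1 ig; rewrite ge0_integral_wgt_conv//.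
apply: lty_pmull; first exact: rBeta_gt0.
by apply: integral_ge0 => x _; rewrite lee_fin normc_ge0.
Qed.

(* The image of w.mu under q is C times the Riemann-Liouville kernel
   r ^ (s - 1) / Gamma(s) dr; these kernels form a convolution semigroup. *)
Definition radial d (T : measurableType d) (mu : {measure set T -> \bar R})
    (w : T -> R[i]) (q : T -> R) (s C : R[i]) :=
  image_rel mu w q leb (wgt s) idfun (C / cGamma s).

(** The weight [wgt (a + 1)] is [r ^ a] on [r > 0], which turns [r ^ (s - 1)] into
    [r ^ (s + a - 1)]. The quotient of Gamma values only restores the normalisation of the
    kernel. *)
Lemma radial_weight d (T : measurableType d) (mu : {measure set T -> \bar R})
    (w : T -> R[i]) (q : T -> R) (s C a : R[i]) :
  0 < complex.Re s -> 0 < complex.Re (s + a) ->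
  radial mu w q s C ->
  radial mu (fun x => w x * wgt (a + 1) (q x)) q (s + a)
    (C * (cGamma (s + a) / cGamma s)).
Proof.
move=> s0 sa0 H; rewrite /radial mulrA mulrAC mulfK ?cGamma_neq0//.
have mu_ : cmeasurable (fun r : RT => wgt (a + 1) r) by exact: measurable_wgt.
have := rel_weight mu_ H; apply: eq_rel => // r.
rewrite /wgt; case: ifPn => r0; last by rewrite mul0r.
by rewrite -cpowD; congr cpow; ring.
Qed.

(** The first factor is replaced by its kernel, the factors are exchanged, the second is replaced
    likewise, and the kernels are convolved. The constant [C / Gamma(s) * D / Gamma(t) * Beta(t, s)]
    equals [C D / Gamma(s + t)]: the division by Gamma in [radial] is what makes constants
    multiply. *)
Lemma radial_prod d1 d2 (T1 : measurableType d1) (T2 : measurableType d2)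
    (m1 : {sigma_finite_measure set T1 -> \bar R}) (w1 : T1 -> R[i]) (q1 : T1 -> R)
    (m2 : {sigma_finite_measure set T2 -> \bar R}) (w2 : T2 -> R[i]) (q2 : T2 -> R)
    (s t C D : R[i]) : 0 < complex.Re s -> 0 < complex.Re t ->
  cmeasurable w1 -> measurable_fun setT q1 ->
  cmeasurable w2 -> measurable_fun setT q2 ->
  radial m1 w1 q1 s C -> radial m2 w2 q2 t D ->
  radial (m1 \x m2)%E (fun p => w1 p.1 * w2 p.2) (fun p => q1 p.1 + q2 p.2)
    (s + t) (C * D).
Proof.
move=> s0 t0 mw1 mq1 mw2 mq2 r1 r2.
have mws : cmeasurable (wgt s : RT -> R[i]) by exact: measurable_wgt.
have mwt : cmeasurable (wgt t : RT -> R[i]) by exact: measurable_wgt.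
have mid : measurable_fun setT (idfun : RT -> R) by exact: measurable_id.
have mW d d' (T : measurableType d) (T' : measurableType d') (w : T -> R[i]) (w' : T' -> R[i]) :
    cmeasurable w -> cmeasurable w' -> cmeasurable (fun p : T * T' => w p.1 * w' p.2).
  by move=> mw mw'; apply: cmeasurableM; apply: cmeasurableT_comp.
have mQ d d' (T : measurableType d) (T' : measurableType d') (q : T -> R) (q' : T' -> R) :
    measurable_fun setT q -> measurable_fun setT q' ->
    measurable_fun setT (fun p : T * T' => q p.1 + q' p.2).
  by move=> mq mq'; apply: measurable_funD; apply: measurableT_comp.
have A := rel_left m2 mw1 mq1 mws mid mw2 mq2 r1.
have B := rel_swap leb m2 mws mid mw2 mq2.
have C' := rel_left leb mw2 mq2 mwt mid mws mid r2.
have E := rel_wgt_conv t0 s0.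
have AB := rel_trans (mW _ _ _ _ _ _ mw1 mw2) (mQ _ _ _ _ _ _ mq1 mq2)
  (mW _ _ _ _ _ _ mws mw2) (mQ _ _ _ _ _ _ mid mq2) A B.
have ABC := rel_trans (mW _ _ _ _ _ _ mw1 mw2) (mQ _ _ _ _ _ _ mq1 mq2)
  (mW _ _ _ _ _ _ mw2 mws) (mQ _ _ _ _ _ _ mq2 mid) AB C'.
have := rel_trans (mW _ _ _ _ _ _ mw1 mw2) (mQ _ _ _ _ _ _ mq1 mq2)
  (mW _ _ _ _ _ _ mwt mws) (mQ _ _ _ _ _ _ mid mid) ABC E.
rewrite /radial [s + t]addrC.
suff -> : C / cGamma s * 1 * (D / cGamma t) * cBeta t s = C * D / cGamma (t + s) by [].
have ts0 : 0 < complex.Re (t + s) by rewrite Re_cD addr_gt0.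
have [gs gt gts] := And3 (cGamma_neq0 s0) (cGamma_neq0 t0) (cGamma_neq0 ts0).
apply: (mulIf gts); rewrite divfK//.
transitivity (C / cGamma s * (D / cGamma t) * (cBeta t s * cGamma (t + s))); first by ring.
by rewrite (cBetaM t0 s0); field; rewrite gs gt.
Qed.

(** Multiplication by a nonnegative weight commutes with taking positive and negative parts, so an
    identity for nonnegative test functions extends to real and then to complex ones. *)
Lemma rel_of_ge0 d1 d2 (T1 : measurableType d1) (T2 : measurableType d2)
    (m1 : {measure set T1 -> \bar R}) (w1 q1 : T1 -> R)
    (m2 : {measure set T2 -> \bar R}) (w2 q2 : T2 -> R) (c : R) :
  (forall x, 0 <= w1 x) -> (forall x, 0 <= w2 x) -> 0 < c ->
  ge0_rel m1 w1 q1 m2 w2 q2 c ->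
  image_rel m1 (fun x => (w1 x)%:C) q1 m2 (fun x => (w2 x)%:C) q2 c%:C.
Proof.
move=> w10 w20 c0 H; split.
  exists c => // g mg g0.
  under eq_integral do rewrite normc_real ger0_norm//.
  under [X in (_ * X)%E]eq_integral do rewrite normc_real ger0_norm//.
  exact: H.
have key (u : RT -> R) : measurable_fun setT u ->
    m1.-integrable setT (EFin \o (fun x => w1 x * u (q1 x))) ->
    \int[m1]_x (w1 x * u (q1 x)) = c * \int[m2]_x (w2 x * u (q2 x)).
  move=> mu iu.
  have E d (T : measurableType d) (w q : T -> R) (x : T) : 0 <= w x ->
      ((fun x => (w x * u (q x))%:E)^\+ x = (w x)%:E * (EFin \o u)^\+ (q x))%E /\
      ((fun x => (w x * u (q x))%:E)^\- x = (w x)%:E * (EFin \o u)^\- (q x))%E.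
    move=> wx; rewrite !funeposE !funenegE; have [a0|/ltW a0] := leP 0 (u (q x)).
      have wa : 0 <= w x * u (q x) by exact: mulr_ge0.
      split; first by rewrite max_l ?lee_fin// max_l ?lee_fin// EFinM.
      by rewrite max_r ?oppe_le0 ?lee_fin// max_r ?oppe_le0 ?lee_fin// mule0.
    have wa : w x * u (q x) <= 0 by exact: mulr_ge0_le0.
    split; first by rewrite max_r ?lee_fin// max_r ?lee_fin// mule0.
    by rewrite max_l ?oppe_ge0 ?lee_fin// max_l ?oppe_ge0 ?lee_fin// EFinM muleN.
  have mE : measurable_fun setT (EFin \o u) by exact/measurable_EFinP.
  have Hp := H _ (measurable_funepos mE) (funepos_ge0 _).
  have Hn := H _ (measurable_funeneg mE) (funeneg_ge0 _).
  have P1 : (\int[m1]_x (fun x => (w1 x * u (q1 x))%:E)^\+ x =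
      c%:E * \int[m2]_x (fun x => (w2 x * u (q2 x))%:E)^\+ x)%E.
    under eq_integral do rewrite (E _ _ w1 q1 _ (w10 _)).1.
    by under [X in (_ * X)%E]eq_integral do rewrite (E _ _ w2 q2 _ (w20 _)).1.
  have N1 : (\int[m1]_x (fun x => (w1 x * u (q1 x))%:E)^\- x =
      c%:E * \int[m2]_x (fun x => (w2 x * u (q2 x))%:E)^\- x)%E.
    under eq_integral do rewrite (E _ _ w1 q1 _ (w10 _)).2.
    by under [X in (_ * X)%E]eq_integral do rewrite (E _ _ w2 q2 _ (w20 _)).2.
  rewrite /Rintegral integralE [in RHS]integralE P1 N1.
  have := integrable_pos_fin_num measurableT iu; rewrite P1 => fp.
  have := integrable_neg_fin_num measurableT iu; rewrite N1 => fn.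
  move: fn fp.
  have : (0 <= \int[m2]_x (fun x => (w2 x * u (q2 x))%:E)^\- x)%E by exact: integral_ge0.
  have : (0 <= \int[m2]_x (fun x => (w2 x * u (q2 x))%:E)^\+ x)%E by exact: integral_ge0.
  (* Since [c > 0], an infinite integral on the [m2] side would contradict the finiteness known on
     the [m1] side. *)
  case: (integral _ _ _) => [p _|_|//]; last by rewrite gt0_muley ?lte_fin.
  case: (integral _ _ _) => [n _ _ _|_|//]; last by rewrite gt0_muley ?lte_fin.
  by rewrite -!EFinM -!EFinB /= mulrBr.
move=> g [g1 g2] [i1 i2].
have ReE d (T : measurableType d) (w q : T -> R) :
    (fun x => complex.Re ((w x)%:C * g (q x))) = (fun x => w x * complex.Re (g (q x))).
  by apply/funext => x; rewrite Re_cM /= mul0r subr0.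
have ImE d (T : measurableType d) (w q : T -> R) :
    (fun x => complex.Im ((w x)%:C * g (q x))) = (fun x => w x * complex.Im (g (q x))).
  by apply/funext => x; rewrite Im_cM /= mul0r addr0.
apply/eqP; rewrite eq_complex Re_cM Im_cM /= !mul0r subr0 addr0 !ReE !ImE.
apply/andP; split; apply/eqP.
  apply: (key (fun r => complex.Re (g r))) => //.
  by rewrite -ReE; exact: i1.
apply: (key (fun r => complex.Im (g r))) => //.
by rewrite -ImE; exact: i2.
Qed.

End radial_measures.

(** * The squared modulus on the plane *)

Section disc.
Context {R : realType}.
Local Notation leb := (@lebesgue_measure R).
Local Notation RT := (measurableTypeR R).
Local Notation lebC := (@lebesgue_measureC R).

(** The open left rays are stable under intersection, generate the Borel sets, exhaust the line
    along the integers and have finite measure, so they determine [nu]. *)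
Lemma halfline_measureE (nu : {measure set RT -> \bar R}) (k : R) : 0 <= k ->
  (forall r, nu `]-oo, r[%classic = (k * Num.max r 0)%:E) ->
  forall A, measurable A -> nu A = (k%:E * leb (A `&` `]0%R, +oo[))%E.
Proof.
move=> k0 H A mA.
have mD : measurable (`]0%R, +oo[%classic : set RT) by exact: measurable_itv.
transitivity (mscale (NngNum k0) (mrestr leb mD) A) => //.
pose m2 : {measure set RT -> \bar R} := mscale (NngNum k0) (mrestr leb mD).
apply: (@measure_unique _ R RT (@RGenInftyO.G R) (fun n => `]-oo, n%:R[%classic)
  _ _ _ _ nu m2) mA.
- exact: RGenInftyO.measurableE.
- move=> _ _ [x ->] [y ->]; exists (Num.min x y); apply/seteqP; split => z /=;
    rewrite !in_itv /= lt_min; [by move=> [-> ->]|by move=> /andP[]].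
- by move=> i; exists i%:R.
- apply/seteqP; split => // x _; exists (Num.truncn `|x|).+1 => //=.
  by rewrite in_itv /= (le_lt_trans (ler_norm _))// truncnS_gt.
- move=> _ [r ->].
  transitivity (k%:E * leb (`]-oo, r[%classic `&` `]0%R, +oo[%classic))%E => //.
  rewrite H.
  rewrite (_ : `]-oo, r[ `&` `]0, +oo[ = `]0, r[%classic); last first.
    by apply/seteqP; split => x /=; rewrite !in_itv /= andbT; [move=> [-> ->]|move=> /andP[]].
  rewrite lebesgue_measure_itv /= lte_fin.
  have [r0|r0] := ltP 0 r; first by rewrite -EFinB subr0 -EFinM.
  by rewrite mulr0 mule0.
- by move=> n; rewrite H ltry.
Qed.

Lemma ge0_integral_halfline (nu : {measure set RT -> \bar R}) (k : R) : 0 <= k ->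
  (forall r, nu `]-oo, r[%classic = (k * Num.max r 0)%:E) ->
  forall g : RT -> \bar R, measurable_fun setT g -> (forall r, 0 <= g r)%E ->
  (\int[nu]_r g r = k%:E * \int[leb]_r ((rwgt 1 r)%:E * g r))%E.
Proof.
move=> k0 H g mg g0; have nuE := halfline_measureE k0 H.
have mD : measurable (`]0%R, +oo[%classic : set RT) by exact: measurable_itv.
have mN : measurable (~` `]0%R, +oo[%classic : set RT) by exact: measurableC.
rewrite (ge0_negligible_integral mN)//; last first.
  by apply: etrans (nuE _ mN) _; rewrite setICl measure0 mule0.
rewrite setTD setCK.
transitivity (\int[mscale (NngNum k0) leb]_(r in `]0%R, +oo[) g r)%E.
  apply: eq_measure_integral => A mA AD.
  by apply: etrans (nuE _ mA) _; rewrite setIidl.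
rewrite ge0_integral_mscale//; last exact: measurable_funTS.
congr (_ * _)%E; rewrite integral_mkcond; apply: eq_integral => r _.
rewrite patchE /rwgt; have [r0|r0] := ltP 0 r.
  by rewrite mem_set /= ?in_itv /= ?r0// subrr powRr0 mul1e.
by rewrite memNset /= ?in_itv /= ?ltNge ?r0// mul0e.
Qed.

Lemma lebCE (A : set (RT * RT)) : measurable A ->
  lebC A = (\int[leb]_x \int[leb]_y (\1_A (x, y))%:E)%E.
Proof.
move=> mA; rewrite -(fubini_tonelli1 (fun p => (\1_A p)%:E)).
- by rewrite integral_indic// setIT.
- by apply/measurable_EFinP; exact: measurable_indic.
- by move=> p; rewrite lee_fin.
Qed.

Lemma ge0_integralC_shift (f : RT * RT -> \bar R) (u v : R) :
  measurable_fun setT f -> (forall p, 0 <= f p)%E ->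
  (\int[lebC]_p f (p.1 + u, p.2 + v)%R = \int[lebC]_p f p)%E.
Proof.
move=> mf f0.
have mh : measurable_fun setT (fun p : RT * RT => f (p.1 + u, p.2 + v)%R).
  by apply: (measurableT_comp mf); apply: measurable_fun_pair; apply: measurable_funD.
rewrite /lebesgue_measureC (fubini_tonelli1 _ mh (fun p => f0 _)) (fubini_tonelli1 _ mf f0).
rewrite /fubini_F.
rewrite -(ge0_integral_shift u (f := fun x => \int[leb]_y f (x, y))%E); last 2 first.
- exact: measurable_fun_fubini_tonelli_F.
- by move=> x; apply: integral_ge0.
apply: eq_integral => x _; rewrite /=.
rewrite -(ge0_integral_shift v (f := fun y => f (x + u, y)%R))//.
by apply: (measurableT_comp mf); exact: measurable_pair1.
Qed.

Let disc (r : R) : set (RT * RT) := [set p | p.1 ^+ 2 + p.2 ^+ 2 < r].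

Let measurable_sqrnorm :
  measurable_fun setT (fun p : RT * RT => p.1 ^+ 2 + p.2 ^+ 2).
Proof.
by apply: measurable_funD; apply: measurable_funX.
Qed.

Let measurable_disc r : measurable (disc r).
Proof.
rewrite -[disc r]setTI; have := measurable_sqrnorm measurableT (measurable_itv `]-oo, r[).
by congr (measurable (_ `&` _)); apply/seteqP; split => p /=; rewrite in_itv.
Qed.

(** Here [r] is the square of the radius: both coordinates are scaled by [sqrt r], and each
    contributes that factor. *)
Let disc_scale r : 0 < r -> lebC (disc r) = (r%:E * lebC (disc 1))%E.
Proof.
move=> r0; pose s := Num.sqrt r.
have s0 : 0 < s by rewrite sqrtr_gt0.
have sE : r = s * s by rewrite -expr2 sqr_sqrtr// ltW.
rewrite !lebCE//.
have mI t : measurable_fun setT (fun p : RT * RT => (\1_(disc t) p)%:E : \bar R).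
  by apply/measurable_EFinP; exact: measurable_indic.
have I0 t (p : RT * RT) : (0 <= (\1_(disc t) p)%:E :> \bar R)%E by rewrite lee_fin.
have aff (f : RT -> \bar R) : measurable_fun setT f -> (forall x, 0 <= f x)%E ->
    (\int[leb]_x f x = s%:E * \int[leb]_x f (s * x)%R)%E.
  move=> mf f0; have := ge0_integral_affine 0 s0 mf f0.
  under eq_integral do rewrite addr0.
  by move=> ->; rewrite muleA -EFinM mulfV ?mul1e// gt_eqF.
have mF : measurable_fun setT (fun x : RT => \int[leb]_y (\1_(disc r) (x, y))%:E)%E.
  exact: (measurable_fun_fubini_tonelli_F _ (mI r) (I0 r)).
rewrite (aff _ mF); last by move=> x; apply: integral_ge0 => y _; exact: I0.
rewrite sE EFinM -muleA; congr (_ * _)%E.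
rewrite -ge0_integralZl//; last 3 first.
- exact: (measurable_fun_fubini_tonelli_F _ (mI 1) (I0 1)).
- by move=> x _; apply: integral_ge0.
- by rewrite lee_fin ltW.
apply: eq_integral => x _; rewrite aff//; last first.
  by apply: (measurableT_comp (mI _)); exact: measurable_pair1.
congr (_ * _)%E; apply: eq_integral => y _; congr (_%:E).
rewrite !indicE; congr (nat_of_bool _)%:R; apply/idP/idP; rewrite !inE /disc /=;
  rewrite !exprMn -mulrDr -expr2 -{2}[s ^+ 2]mulr1 ltr_pM2l ?exprn_gt0//.
Qed.

Let disc1_lty : (lebC (disc 1) < +oo)%E.
Proof.
pose I := `[(-1 : R), 1]%classic : set RT.
have mI : measurable I by exact: measurable_itv.
apply: (@le_lt_trans _ _ (lebC (I `*` I))).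
  apply: le_measure; rewrite ?inE; [exact: measurable_disc|exact: measurableX|].
  move=> [x y]; rewrite /disc /I /= !in_itv /= => h.
  have sq1 (t : R) : t ^+ 2 < 1 -> (-1 <= t <= 1).
    move=> ht; rewrite -ler_norml -(ler_pXn2r (ltn0Sn 1))// ?nnegrE//.
    by rewrite expr1n real_normK ?num_real// ltW.
  by split; apply: sq1; apply: le_lt_trans h; rewrite ?lerDl ?lerDr sqr_ge0.
apply: le_lt_trans (_ : (leb I * leb I < +oo)%E).
  by rewrite /lebesgue_measureC product_measure1E.
by rewrite /I lebesgue_measure_itv /= lte_fin; case: ifP => _;
  rewrite ?mule0 -?EFinD -?EFinM ltry.
Qed.

(** Scaling of discs alone shows that the image of plane measure is constant times length on the
    half-line. The constant is first left as the area [V] of the unit disc, so polar coordinates are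
    not involved. *)
Lemma ge0_integralC_sqrnorm (b : R) (g : RT -> \bar R) : 0 < b ->
  measurable_fun setT g -> (forall r, 0 <= g r)%E ->
  (\int[lebC]_p g (b * (p.1 ^+ 2 + p.2 ^+ 2))%R =
   (pi / b)%:E * \int[leb]_r ((rwgt 1 r)%:E * g r))%E.
Proof.
pose V := fine (lebC (disc 1)).
have V0 : 0 <= V by rewrite fine_ge0.
have VE : lebC (disc 1) = V%:E by rewrite fineK// ge0_fin_numE.
have key (c : R) (f : RT -> \bar R) : 0 < c ->
    measurable_fun setT f -> (forall r, 0 <= f r)%E ->
    (\int[lebC]_p f (c * (p.1 ^+ 2 + p.2 ^+ 2))%R =
     (V / c)%:E * \int[leb]_r ((rwgt 1 r)%:E * f r))%E.
  move=> c0 mf f0.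
  have mphi : measurable_fun setT
      ((fun p : RT * RT => c * (p.1 ^+ 2 + p.2 ^+ 2)) : RT * RT -> RT).
    exact: measurable_funM.
  pose nu : {measure set RT -> \bar R} :=
    measure_function_pushforward__canonical__measure_function_Measure lebC mphi.
  rewrite -(@ge0_integral_halfline nu (V / c))//.
  - by rewrite (ge0_integral_image (mu := lebC) (nu := nu) mphi).
  - by rewrite divr_ge0// ltW.
  - move=> r; transitivity (lebC (disc (r / c))).
      congr (lebC _); apply/seteqP; split => p /=;
        by rewrite in_itv /= /disc /= ltr_pdivlMr// mulrC.
    have [r0|r0] := ltP 0 r.
      by rewrite disc_scale ?divr_gt0// VE -EFinM; congr EFin; field; rewrite gt_eqF.
    rewrite mulr0 (_ : disc _ = set0) ?measure0//.
    apply/seteqP; split => // p; rewrite /disc /= => h.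
    have := lt_le_trans h (mulr_le0_ge0 r0 (ltW (_ : 0 < c^-1))).
    by rewrite invr_gt0 => /(_ c0); rewrite ltNge addr_ge0// sqr_ge0.
(* Testing with [exp(-r)] gives [V * Gamma(1)] on the line and, in the plane, the square of the
   Gaussian integral [sqrt pi]. *)
have Vpi : V = pi.
  have mE : measurable_fun setT (fun t : RT => (expR (- t))%:E).
    by apply/measurable_EFinP; exact: measurable_expRN.
  have E0 (t : R) : (0 <= (expR (- t))%:E)%E by rewrite lee_fin expR_ge0.
  have := key 1 _ ltr01 mE E0.
  rewrite invr1 mulr1 (_ : (\int[leb]_r _)%E = eGamma 1); last first.
    by apply: eq_integral => t _; rewrite EFinM.
  rewrite eGamma1 mule1 => h; apply/esym/EFin_inj; rewrite -h.
  have mg : measurable_fun setT (fun x : RT => (gauss_fun x)%:E).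
    by apply/measurable_EFinP; exact: measurable_gauss_fun.
  have g0 (x : RT) : (0 <= (gauss_fun x)%:E)%E by rewrite lee_fin gauss_fun_ge0.
  rewrite /lebesgue_measureC fubini_tonelli1; last 2 first.
  - by apply: (measurableT_comp mE); exact: measurable_funM.
  - by move=> p; exact: E0.
  transitivity (\int[leb]_x ((gauss_fun x)%:E * (Num.sqrt pi)%:E))%E.
    rewrite ge0_integralZr// ?lee_fin ?sqrtr_ge0//.
    by rewrite integralT_gauss -EFinM -expr2 sqr_sqrtr// pi_ge0.
  apply: eq_integral => x _; rewrite -integralT_gauss -ge0_integralZl//.
  apply: eq_integral => y _; rewrite -EFinM /= /gauss_fun -expRD mul1r opprD.
  by [].
by move=> b0 mg g0; rewrite key// Vpi.
Qed.

Lemma radial_C (b : R) : 0 < b ->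
  radial lebC (fun=> 1) (fun p : RT * RT => b * (p.1 ^+ 2 + p.2 ^+ 2)) 1 (pi / b)%:C.
Proof.
move=> b0; rewrite /radial.
have -> : cGamma (1 : R[i]) = 1.
  by rewrite -[1 in LHS]/(1%:C) cGamma_real /rGamma eGamma1.
have H : image_rel lebC (fun=> (1 : R)%:C) (fun p : RT * RT => b * (p.1 ^+ 2 + p.2 ^+ 2))
    leb (fun r => (rwgt 1 r)%:C) idfun (pi / b)%:C.
  apply: rel_of_ge0 => //; first exact: rwgt_ge0.
    by rewrite divr_gt0// pi_gt0.
  move=> g mg g0; under eq_integral do rewrite mul1e.
  exact: ge0_integralC_sqrnorm.
by rewrite divr1; apply: eq_rel H => // r; rewrite -wgt_real.
Qed.

End disc.

(** * Completing the square *)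

Section hermitian_schur.
Local Open Scope ring_scope.
Local Open Scope sesquilinear_scope.
Context {C : numClosedFieldType}.

Definition hform m (A : 'M[C]_m) (X : 'cV[C]_m) : C := (X ^t* *m A *m X) 0 0.

Lemma adjmxM m n p (A : 'M[C]_(m, n)) (B : 'M[C]_(n, p)) :
  (A *m B) ^t* = B ^t* *m A ^t*.
Proof. by rewrite trmx_mul map_mxM. Qed.

Lemma adjmxK m n (A : 'M[C]_(m, n)) : A ^t* ^t* = A.
Proof. by apply/matrixP => i j; rewrite !mxE conjCK. Qed.

Lemma hermsymmxP m (A : 'M[C]_m) : reflect (A = A ^t*) (A \is hermsymmx).
Proof.
by apply: (iffP (is_hermitianmxP _ _ _)); rewrite expr0 scale1r.
Qed.

Lemma mulmx11 (A B : 'M[C]_1) : (A *m B) 0 0 = A 0 0 * B 0 0.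
Proof. by rewrite !mxE big_ord1. Qed.

Section schur.
Variables (n : nat) (B : 'M[C]_(1 + n)).
Hypothesis hB : B \is hermsymmx.
Local Notation b := (B 0 0).
Local Notation u := (dlsubmx B).

(** The shift that completes the square: for positive definite [B], the form at fixed [X] is minimal
    over the first coordinate at [- schur_form X]. *)
Definition schur_form (X : 'cV[C]_n) : C := b^-1 * (u ^t* *m X) 0 0.

Definition schur_compl : 'M[C]_n := drsubmx B - b^-1 *: (u *m u ^t*).

Lemma herm_blockE : B = block_mx b%:M (u ^t*) u (drsubmx B).
Proof.
rewrite -[LHS]submxK; congr block_mx.
  by rewrite [LHS]mx11_scalar !mxE; congr (B _ _)%:M; apply/val_inj.
by rewrite {1}(hermsymmxP _ hB) -map_ursubmx -trmx_dlsub.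
Qed.

Lemma herm_conj00 : b^* = b.
Proof. by rewrite {2}(hermsymmxP _ hB) !mxE. Qed.

Lemma herm_schur_compl : schur_compl \is hermsymmx.
Proof.
apply/hermsymmxP; rewrite /schur_compl linearB /= map_mxB; congr (_ - _).
  by rewrite {1}(hermsymmxP _ hB) -map_drsubmx -trmx_drsub.
by rewrite linearZ /= map_mxZ adjmxM adjmxK fmorphV /= herm_conj00.
Qed.

Hypothesis b0 : b != 0.

Lemma det_schur : \det B = b * \det schur_compl.
Proof.
have E : B = block_mx 1%:M 0 (b^-1 *: u) 1%:M *m block_mx b%:M (u ^t*) 0 schur_compl.
  rewrite {1}herm_blockE mulmx_block !mul1mx !mul0mx !addr0 -!scalemxAl; congr block_mx.
    by rewrite mul_mx_scalar scalerA mulVf// scale1r.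
  by rewrite /schur_compl addrC subrK.
rewrite {1}E det_mulmx det_lblock det_ublock !det1 !mul1r; congr (_ * _).
by rewrite det_scalar1.
Qed.

(** As [b] is real, expanding the square reproduces the terms in [x] and leaves an excess
    [|u^* X|^2 / b], which is what the Schur complement subtracts. *)
Lemma hform_schur (x : C) (X : 'cV[C]_n) :
  hform B (col_mx x%:M X) =
  b * ((x + schur_form X) * (x + schur_form X)^*) + hform schur_compl X.
Proof.
have PE : X ^t* *m u = (u ^t* *m X) ^t* by rewrite adjmxM adjmxK.
rewrite /hform {1}herm_blockE tr_col_mx map_row_mx mul_row_block mul_row_col.
rewrite /schur_compl mulmxBr mulmxBl -!scalemxAr -!scalemxAl !mulmxDl.
rewrite (mulmxA _ u) -(mulmxA _ (u ^t*) X) PE -!(mulmxA _ (u ^t*) X).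
set P := u ^t* *m X.
rewrite tr_scalar_mx map_scalar_mx /=.
have DE (M N : 'M[C]_1) : (M + N) 0 0 = M 0 0 + N 0 0 by rewrite mxE.
have NE (M : 'M[C]_1) : (- M) 0 0 = - M 0 0 by rewrite mxE.
have ZE a (M : 'M[C]_1) : (a *: M) 0 0 = a * M 0 0 by rewrite mxE.
have SE (a : C) : (a%:M : 'M[C]_1) 0 0 = a by rewrite mxE eqxx mulr1n.
have JE (M : 'M[C]_1) : (M ^t*) 0 0 = (M 0 0)^* by rewrite !mxE.
rewrite !(DE, NE, ZE, mulmx11, SE, JE) /schur_form -/P.
have bV : (b^-1)^* = b^-1 by rewrite fmorphV /= herm_conj00.
by rewrite rmorphD rmorphM /= bV; field.
Qed.

End schur.

End hermitian_schur.

Section complex_forms.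
Context {R : realType}.
Local Notation RT := (measurableTypeR R).
Local Open Scope ring_scope.

Lemma conjCE (z : R[i]) : Num.conj z = complex.Re z +i* (- complex.Im z).
Proof. by case: z. Qed.

Lemma quadformE m (A : 'M[R[i]]_m) X : quadform A X = complex.Re (hform A X).
Proof. by []. Qed.

Lemma posdef_schur n (B : 'M[R[i]]_(1 + n)) : posdefmx B ->
  [/\ 0 < complex.Re (B 0 0), B 0 0 = (complex.Re (B 0 0))%:C &
     posdefmx (schur_compl B)].
Proof.
move=> [hB pB].
have b_gt0 : 0 < B 0 0.
  have d0 : (delta_mx 0 0 : 'cV[R[i]]_(1 + n)) != 0.
    apply/eqP => /matrixP /(_ 0 0); rewrite !mxE !eqxx /= => /eqP.
    by rewrite oner_eq0.
  have := pB _ d0; congr (0 < _).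
  by rewrite trmx_delta map_delta_mx -rowE -colE !mxE.
have bE : B 0 0 = (complex.Re (B 0 0))%:C.
  by move: b_gt0; case: (B 0 0) => x y; rewrite ltcE /= => /andP[/eqP ->].
have b0 : B 0 0 != 0 by rewrite gt_eqF.
split => //; first by move: b_gt0; rewrite ltcE => /andP[].
split; first exact: herm_schur_compl.
move=> X X0.
(* At this vector the square vanishes, so positivity of [B] there is positivity of the Schur
   complement at [X]. *)
have V0 : col_mx (- schur_form B X)%:M X != 0.
  by apply: contra X0 => /eqP /(congr1 dsubmx); rewrite col_mxKd linear0 => ->.
have := pB _ V0; rewrite -[X in 0 < X -> _]/(hform B _) hform_schur//.
by rewrite addNr mul0r mulr0 add0r.
Qed.

Lemma quadform_schur n (B : 'M[R[i]]_(1 + n)) (x : R[i]) X : posdefmx B ->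
  quadform B (col_mx x%:M X) = complex.Re (B 0 0) *
    ((complex.Re x + complex.Re (schur_form B X)) ^+ 2 +
     (complex.Im x + complex.Im (schur_form B X)) ^+ 2) +
  quadform (schur_compl B) X.
Proof.
move=> pB; have [b0 bE _] := posdef_schur pB; have [hB _] := pB.
rewrite !quadformE hform_schur//; last by rewrite bE (inj_eq (@complexI R)) gt_eqF.
rewrite raddfD /= {1}bE; congr (_ + _).
rewrite conjCE; case: (schur_form B X) => y1 y2; case: x => x1 x2 /=.
by rewrite mul0r subr0; congr (_ * _); ring.
Qed.

Lemma det_posdef_schur n (B : 'M[R[i]]_(1 + n)) : posdefmx B ->
  \det B = (complex.Re (B 0 0))%:C * \det (schur_compl B).
Proof.
move=> pB; have [b0 bE _] := posdef_schur pB; have [hB _] := pB.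
by rewrite {1}(det_schur hB) -?bE//; rewrite bE (inj_eq (@complexI R)) gt_eqF.
Qed.

Lemma posdef_det_neq0 n (B : 'M[R[i]]_n) : posdefmx B -> \det B != 0.
Proof.
elim: n B => [|n IH] B pB; first by rewrite det_mx00 oner_eq0.
have [b0 _ pS] := @posdef_schur n B pB.
rewrite (@det_posdef_schur n B pB) mulf_neq0 ?IH//.
by rewrite (inj_eq (@complexI R)) gt_eqF.
Qed.

End complex_forms.

Section complex_vectors.
Context {R : realType}.
Local Notation RT := (measurableTypeR R).
Local Notation lebC := (@lebesgue_measureC R).
Local Notation lebCn := (@lebesgue_measureCn R).
Local Open Scope sesquilinear_scope.
Local Open Scope ring_scope.

Lemma cvec_of_tupleE n (t : n.-tuple (RT * RT)) i :
  cvec_of_tuple t i 0 = (tnth t i).1 +i* (tnth t i).2.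
Proof. by rewrite mxE. Qed.

Lemma cvec_of_tuple_cons n (x : RT * RT) (t : n.-tuple (RT * RT)) :
  cvec_of_tuple (tcons (x, t)) = col_mx (x.1 +i* x.2)%:M (cvec_of_tuple t) :> 'cV_(1 + n).
Proof.
apply/matrixP => i j; rewrite (ord1 j) cvec_of_tupleE.
case: (unliftP ord0 i) => [k|] ->.
  have -> : lift ord0 k = rshift 1 k :> 'I_(1 + n) by apply/val_inj.
  rewrite col_mxEd cvec_of_tupleE.
  have -> : rshift 1 k = lift ord0 k by apply/val_inj.
  by rewrite (_ : tcons _ = [tuple of x :: t])//; rewrite tnthS.
have -> : ord0 = lshift n ord0 :> 'I_(1 + n) by apply/val_inj.
by rewrite col_mxEu mxE eqxx mulr1n.
Qed.

Section measurability.
Context d (T : measurableType d).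

Lemma cmeasurable_sum (I : Type) (s : seq I) (F : I -> T -> R[i]) :
  (forall i, cmeasurable (F i)) -> cmeasurable (fun x => \sum_(i <- s) F i x).
Proof.
move=> mF; elim: s => [|i s IH].
  by under eq_fun do rewrite big_nil; exact: cmeasurable_cst.
by under eq_fun do rewrite big_cons; exact: cmeasurableD.
Qed.

Lemma cmeasurable_conj (f : T -> R[i]) :
  cmeasurable f -> cmeasurable (fun x => Num.conj (f x)).
Proof.
move=> [f1 f2]; split.
  by rewrite (_ : _ \o _ = @complex.Re R \o f)//; apply/funext => x /=; rewrite conjCE.
rewrite (_ : _ \o _ = (fun x => - complex.Im (f x))).
  exact: measurable_funN.
by apply/funext => x /=; rewrite conjCE.
Qed.

Lemma cmeasurable_mulmx m n p (F : T -> 'M[R[i]]_(m, n)) (G : T -> 'M[R[i]]_(n, p)) :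
  (forall i j, cmeasurable (fun x => F x i j)) ->
  (forall i j, cmeasurable (fun x => G x i j)) ->
  forall i j, cmeasurable (fun x => (F x *m G x) i j).
Proof.
move=> mF mG i j; under eq_fun do rewrite mxE.
by apply: cmeasurable_sum => k; exact: cmeasurableM.
Qed.

Lemma measurable_quadform n (A : 'M[R[i]]_n) (F : T -> 'cV[R[i]]_n) :
  (forall i, cmeasurable (fun x => F x i 0)) ->
  measurable_fun setT (fun x => quadform A (F x)).
Proof.
move=> mF.
have mF' i j : cmeasurable (fun x => F x i j) by rewrite (ord1 j).
have [] // : cmeasurable (fun x => ((F x) ^t* *m A *m F x) 0 0).
apply: cmeasurable_mulmx => //; apply: cmeasurable_mulmx => i j.
  by under eq_fun do rewrite !mxE; exact: cmeasurable_conj.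
exact: cmeasurable_cst.
Qed.

Lemma cmeasurable_schur_form n (A : 'M[R[i]]_(1 + n)) (F : T -> 'cV[R[i]]_n) :
  (forall i, cmeasurable (fun x => F x i 0)) ->
  cmeasurable (fun x => schur_form A (F x)).
Proof.
move=> mF; have mF' i j : cmeasurable (fun x => F x i j) by rewrite (ord1 j).
apply: cmeasurableM; first exact: cmeasurable_cst.
by apply: cmeasurable_mulmx => // i j; exact: cmeasurable_cst.
Qed.

End measurability.

Lemma cmeasurable_cvec n i :
  cmeasurable (fun t : n.-tuple (RT * RT) => cvec_of_tuple t i 0).
Proof.
split.
  rewrite (_ : _ \o _ = fun t : n.-tuple (RT * RT) => (tnth t i).1).
    by apply: (measurableT_comp measurable_fst); exact: measurable_tnth.
  by apply/funext => t; rewrite /= cvec_of_tupleE.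
rewrite (_ : _ \o _ = fun t : n.-tuple (RT * RT) => (tnth t i).2).
  by apply: (measurableT_comp measurable_snd); exact: measurable_tnth.
by apply/funext => t; rewrite /= cvec_of_tupleE.
Qed.

Lemma lebCn_cons n A : measurable A ->
  lebCn n.+1 A = (lebC \x lebCn n)%E ((@tcons _ (RT * RT)%type n) @^-1` A).
Proof. by []. Qed.

(** At fixed second component the map is a translation of the plane; integrating over the plane
    first reduces the claim to translation invariance. *)
Lemma shear_image n (l1 l2 : n.-tuple (RT * RT) -> RT) :
  measurable_fun setT l1 -> measurable_fun setT l2 ->
  let phi (p : (RT * RT) * n.-tuple (RT * RT)) :=
    ((p.1.1 + l1 p.2, p.1.2 + l2 p.2), p.2) in
  measurable_fun setT phi /\
  forall A, measurable A ->
  (lebC \x lebCn n)%E A = (lebC \x lebCn n)%E (phi @^-1` A).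
Proof.
move=> ml1 ml2 phi.
have mphi : measurable_fun setT phi.
  apply: measurable_fun_pair; last exact: measurable_snd.
  apply: measurable_fun_pair; apply: measurable_funD.
  - by apply: (measurableT_comp measurable_fst); exact: measurable_fst.
  - by apply: (measurableT_comp ml1); exact: measurable_snd.
  - by apply: (measurableT_comp measurable_snd); exact: measurable_fst.
  - by apply: (measurableT_comp ml2); exact: measurable_snd.
split=> // A mA.
have mA' : measurable (phi @^-1` A).
  by rewrite -[X in measurable X]setTI; exact: mphi.
have mI (D : set ((RT * RT) * n.-tuple (RT * RT))) : measurable D ->
    measurable_fun setT (fun p => (\1_D p)%:E : \bar R).
  by move=> mD; apply/measurable_EFinP; exact: measurable_indic.
have E D : measurable D -> (lebC \x lebCn n)%E D =
    (\int[lebCn n]_t \int[lebC]_p (\1_D (p, t))%:E)%E.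
  move=> mD; rewrite -(fubini_tonelli2 _ (mI _ mD)).
    by rewrite integral_indic// setIT.
  by move=> p; rewrite lee_fin.
rewrite (E _ mA) (E _ mA'); apply: eq_integral => t _.
rewrite -(@ge0_integralC_shift _ (fun p => (\1_A (p, t))%:E) (l1 t) (l2 t)).
- by apply: eq_integral => p _; rewrite !indicE.
- by apply: (measurableT_comp (mI _ mA)); exact: measurable_pair2.
- by move=> p; rewrite lee_fin.
Qed.

End complex_vectors.

Section single_block.
Context {R : realType}.
Local Notation RT := (measurableTypeR R).
Local Notation lebC := (@lebesgue_measureC R).
Local Notation lebCn := (@lebesgue_measureCn R).
Local Open Scope ring_scope.

Lemma measurable_quadform_cvec n (A : 'M[R[i]]_n) :
  measurable_fun setT (fun t : n.-tuple (RT * RT) => quadform A (cvec_of_tuple t)).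
Proof. by apply: measurable_quadform => i; exact: cmeasurable_cvec. Qed.

(** The shear by [schur_form] preserves Lebesgue measure and removes the cross terms, so the first
    coordinate and the remaining ones contribute independently to the form. *)
Lemma rel_complete_square n (B : 'M[R[i]]_(1 + n)) : posdefmx B ->
  image_rel (lebCn n.+1) (fun=> 1) (fun t => quadform (B : 'M[R[i]]_(n.+1)) (cvec_of_tuple t))
      (lebC \x lebCn n)%E (fun=> 1)
      (fun p => complex.Re (B 0 0) * (p.1.1 ^+ 2 + p.1.2 ^+ 2) +
                quadform (schur_compl B) (cvec_of_tuple p.2)) 1.
Proof.
move=> pB.
have m1 d (T : measurableType d) : cmeasurable ((fun=> 1) : T -> R[i]).
  exact: cmeasurable_cst.
have mqB := @measurable_quadform_cvec n.+1 B.
pose qS (p : (RT * RT) * n.-tuple (RT * RT)) :=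
  complex.Re (B 0 0) * (p.1.1 ^+ 2 + p.1.2 ^+ 2) +
    quadform (schur_compl B) (cvec_of_tuple p.2).
have mqS : measurable_fun setT qS.
  apply: measurable_funD.
    apply: measurable_funM => //; apply: measurable_funD; apply: measurable_funX.
      by apply: (measurableT_comp measurable_fst); exact: measurable_fst.
    by apply: (measurableT_comp measurable_snd); exact: measurable_fst.
  by apply: (measurableT_comp (measurable_quadform_cvec _)); exact: measurable_snd.
have [mf1 mf2] := @cmeasurable_schur_form R _ _ n B _ (@cmeasurable_cvec R n).
have [mphi phiE] := shear_image mf1 mf2.
have mt := @measurable_tcons _ (RT * RT)%type n.
have R1 := rel_image_sym mt (@lebCn_cons R n) (m1 _ _) mqB.
have R2 := @rel_image R _ _ _ _ (lebC \x lebCn n)%E (lebC \x lebCn n)%E _ _ qS mphi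
  phiE (m1 _ _) mqS.
have mqt : measurable_fun setT (fun p => quadform (B : 'M[R[i]]_(n.+1)) (cvec_of_tuple (tcons p))).
  exact: measurableT_comp mqB mt.
apply: (rel_trans1 (m1 _ _) mqB (m1 _ _) mqt R1).
apply: eq_rel R2 => // -[x t].
by rewrite /qS /= cvec_of_tuple_cons quadform_schur.
Qed.

Lemma rel_tuple0 (q : RT * RT -> R) : measurable_fun setT q ->
  image_rel (lebC \x lebCn 0)%E (fun=> 1) (fun p => q p.1) lebC (fun=> 1) q 1.
Proof.
move=> mq; apply: (rel_image measurable_fst) => // [A mA|]; last exact: cmeasurable_cst.
rewrite (_ : fst @^-1` A = A `*` setT); last first.
  by apply/seteqP; split => -[x t] //= [].
apply: esym; apply: etrans (product_measure1E _ _ mA measurableT) _.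
have -> : lebCn 0 setT = 1%E by rewrite /= diracE mem_set.
by rewrite mule1.
Qed.

(** Each coordinate adds [1] to the parameter and a factor [pi / b] to the constant, where [b] is
    the current corner entry; [det B = b det S], with [S] the Schur complement, collects these
    corners into the determinant. The induction starts at one coordinate, because with none the form
    is [0] and its image a point mass. *)
Lemma radial_block n (B : 'M[R[i]]_n.+1) : posdefmx B ->
  radial (lebCn n.+1) (fun=> 1) (fun t => quadform B (cvec_of_tuple t))
    n.+1%:R ((pi ^+ n.+1)%:C / \det B).
Proof.
have m1 d (T : measurableType d) : cmeasurable ((fun=> 1) : T -> R[i]).
  exact: cmeasurable_cst.
have mqb (b : R) : measurable_fun setT (fun p : RT * RT => b * (p.1 ^+ 2 + p.2 ^+ 2)).
  by apply: measurable_funM => //; apply: measurable_funD; apply: measurable_funX.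
have o1 : 0 < complex.Re (1 : R[i]) by [].
have step m (B' : 'M[R[i]]_(1 + m)) (C : R[i]) s : posdefmx B' ->
    radial (lebC \x lebCn m)%E (fun=> 1)
      (fun p => complex.Re (B' 0 0) * (p.1.1 ^+ 2 + p.1.2 ^+ 2) +
                quadform (schur_compl B') (cvec_of_tuple p.2)) s C ->
    radial (lebCn m.+1) (fun=> 1) (fun t => quadform (B' : 'M[R[i]]_(m.+1)) (cvec_of_tuple t)) s C.
  move=> pB' H; apply: (rel_trans1 _ _ _ _ (rel_complete_square pB') H) => //.
    exact: measurable_quadform_cvec.
  apply: measurable_funD.
    by apply: (measurableT_comp (mqb _)); exact: measurable_fst.
  by apply: (measurableT_comp (measurable_quadform_cvec _)); exact: measurable_snd.
elim: n B => [|n IH] B pB.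
  have [b0 bE pS] := posdef_schur (pB : posdefmx (B : 'M[R[i]]_(1 + 0))).
  apply: (step 0%N B) => //.
  rewrite det_mx11 {2}bE expr1 -rmorphV ?unitfE ?gt_eqF// -rmorphM /=.
  have mq0 : measurable_fun setT (fun p : (RT * RT) * 0.-tuple (RT * RT) =>
      complex.Re (B 0 0) * (p.1.1 ^+ 2 + p.1.2 ^+ 2)).
    by apply: (measurableT_comp (mqb _)); exact: measurable_fst.
  have H := rel_trans1 (m1 _ _) mq0 (m1 _ _) (mqb _) (rel_tuple0 (mqb _)) (radial_C b0).
  by apply: eq_rel H => // p; rewrite /quadform mxE big_ord0 addr0.
have [b0 bE pS] := posdef_schur (pB : posdefmx (B : 'M[R[i]]_(1 + n.+1))).
apply: (step n.+1 B) => //.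
have n0 : 0 < complex.Re (n.+1%:R : R[i]).
  by rewrite -(rmorph_nat (real_complex R)) ltr0n.
have := radial_prod o1 n0 (m1 _ _) (mqb _) (m1 _ _) (measurable_quadform_cvec _) (radial_C b0) (IH _ pS).
have -> : (pi / complex.Re (B 0 0))%:C * ((pi ^+ n.+1)%:C / \det (schur_compl (B : 'M[R[i]]_(1 + n.+1)))) =
    (pi ^+ n.+2)%:C / \det B.
  rewrite (@det_posdef_schur _ n.+1 B pB) (exprS pi n.+1) !rmorphM /= fmorphV; field.
  by rewrite posdef_det_neq0//= (inj_eq (@complexI R)) gt_eqF.
rewrite nat1r.
by apply: eq_rel => // p; rewrite mulr1.
Qed.

End single_block.

(** * Products of blocks *)

Section block_product.
Context {R : realType}.
Local Notation RT := (measurableTypeR R).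
Local Notation lebC := (@lebesgue_measureC R).
Local Notation lebCn := (@lebesgue_measureCn R).
Local Open Scope ring_scope.

Definition tcat m n (p : m.-tuple (RT * RT) * n.-tuple (RT * RT)) :
  (m + n).-tuple (RT * RT) := [tuple of p.1 ++ p.2].

Lemma measurable_tcat m n : measurable_fun setT (@tcat m n).
Proof.
apply/measurable_fun_tnthP => i; case: (split_ordP i) => j ->.
  rewrite (_ : _ \o _ = (fun p : m.-tuple (RT * RT) * n.-tuple (RT * RT) => tnth p.1 j)).
    by apply: (measurableT_comp (measurable_tnth j)); exact: measurable_fst.
  by apply/funext => p; rewrite /= tnth_lshift.
rewrite (_ : _ \o _ = (fun p : m.-tuple (RT * RT) * n.-tuple (RT * RT) => tnth p.2 j)).
  by apply: (measurableT_comp (measurable_tnth j)); exact: measurable_snd.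
by apply/funext => p; rewrite /= tnth_rshift.
Qed.

Lemma ge0_integral_tcons n (f : n.+1.-tuple (RT * RT) -> \bar R) :
  measurable_fun setT f -> (forall t, 0 <= f t)%E ->
  (\int[lebCn n.+1]_t f t = \int[lebC]_x \int[lebCn n]_t f (tcons (x, t)))%E.
Proof.
move=> mf f0.
rewrite (ge0_integral_image (@measurable_tcons _ (RT * RT)%type n) (@lebCn_cons R n))//.
rewrite fubini_tonelli1//.
by apply: (measurableT_comp mf); exact: measurable_tcons.
Qed.

Lemma ge0_integral_tcat m n (f : (m + n).-tuple (RT * RT) -> \bar R) :
  measurable_fun setT f -> (forall t, 0 <= f t)%E ->
  (\int[lebCn (m + n)]_t f t = \int[lebCn m]_t \int[lebCn n]_u f (tcat (t, u)))%E.
Proof.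
elim: m f => [|m IH] f mf f0.
  rewrite [RHS](integral_dirac ([tuple] : 0.-tuple (RT * RT)) measurableT); last first.
    exact: (measurable_fun_fubini_tonelli_F (fun p => f (tcat p))
      (measurableT_comp mf (@measurable_tcat 0 n)) (fun p => f0 _)).
  rewrite diracT mul1e; apply: eq_integral => t _; congr f; exact/val_inj.
rewrite [LHS](@ge0_integral_tcons (m + n) f mf f0).
rewrite [RHS]ge0_integral_tcons; last 2 first.
- have mft : measurable_fun setT (fun p : m.+1.-tuple (RT * RT) * n.-tuple (RT * RT) => f (tcat p)).
    exact: measurableT_comp mf (@measurable_tcat m.+1 n).
  exact: (measurable_fun_fubini_tonelli_F (m2 := lebCn n) _ mft (fun p => f0 _)).
- by move=> t; exact: integral_ge0.
apply: eq_integral => x _.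
rewrite IH//; last first.
  apply: (measurableT_comp mf); apply: (measurableT_comp (@measurable_tcons _ (RT * RT)%type _)).
  exact: measurable_pair1.
apply: eq_integral => t _; apply: eq_integral => u _; congr f; exact/val_inj.
Qed.

Lemma lebCn_cat m n A : measurable A ->
  lebCn (m + n) A = (lebCn m \x lebCn n)%E ((@tcat m n) @^-1` A).
Proof.
move=> mA.
have mI : measurable_fun setT (fun t : (m + n).-tuple (RT * RT) => (\1_A t)%:E : \bar R).
  by apply/measurable_EFinP; exact: measurable_indic.
have mA' : measurable (@tcat m n @^-1` A).
  by rewrite -[X in measurable X]setTI; exact: measurable_tcat.
have I0 t : (0 <= (\1_A t)%:E :> \bar R)%E by rewrite lee_fin.
have := ge0_integral_tcat mI I0; rewrite integral_indic// setIT => ->.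
rewrite -[RHS](_ : \int[(lebCn m \x lebCn n)%E]_p (\1_(@tcat m n @^-1` A) p)%:E = _)%E.
  rewrite fubini_tonelli1//; first by apply/measurable_EFinP; exact: measurable_indic.
by rewrite integral_indic// setIT.
Qed.

End block_product.

Section blocks.
Context {R : realType}.
Local Notation RT := (measurableTypeR R).
Local Notation lebCn := (@lebesgue_measureCn R).
Local Open Scope ring_scope.

Lemma Re_natr m : complex.Re (m%:R : R[i]) = m%:R.
Proof. by rewrite -(rmorph_nat (real_complex R)). Qed.

Lemma radial_block_weight m (B : 'M[R[i]]_m) (a : R[i]) :
  (0 < m)%N -> posdefmx B -> 0 < complex.Re a ->
  radial (lebCn m) (fun t => wgt (a + 1) (quadform B (cvec_of_tuple t)))
    (fun t => quadform B (cvec_of_tuple t)) (a + m%:R)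
    ((pi ^+ m)%:C / \det B * (cGamma (a + m%:R) / cGamma m%:R)).
Proof.
case: m B => // m B _ pB a0; rewrite (addrC a m.+1%:R).
have := @radial_weight R _ _ _ _ _ _ _ a _ _ (radial_block pB).
rewrite Re_cD Re_natr ltr0n addr_gt0 ?ltr0n// => /(_ isT isT).
by apply: eq_rel => // t; rewrite mul1r.
Qed.

(** Blocks are chosen by an arbitrary [sigma], so that removing the first one in an induction
    changes [sigma] and needs no cast; [blocks] is the case [sigma = tagnat.Rank]. *)
Definition slice N k (n : 'I_k -> nat) (sigma : forall j, 'I_(n j) -> 'I_N)
  (t : N.-tuple (RT * RT)) (j : 'I_k) : 'cV[R[i]]_(n j) :=
  \col_i cvec_of_tuple t (sigma j i) 0.

Section slice_measurability.
Variables (N k : nat) (n : 'I_k -> nat) (sigma : forall j, 'I_(n j) -> 'I_N).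
Variables (B : forall j, 'M[R[i]]_(n j)) (alpha : 'I_k -> R[i]).

Lemma measurable_quadform_slice j :
  measurable_fun setT (fun t => quadform (B j) (slice sigma t j)).
Proof.
apply: measurable_quadform => i; under eq_fun do rewrite mxE.
exact: cmeasurable_cvec.
Qed.

Lemma measurable_sum_slice :
  measurable_fun setT (fun t => \sum_j quadform (B j) (slice sigma t j)).
Proof. by apply: measurable_sum => j; exact: measurable_quadform_slice. Qed.

Lemma measurable_prod_slice :
  cmeasurable (fun t => \prod_j wgt (alpha j + 1) (quadform (B j) (slice sigma t j))).
Proof.
apply: cmeasurable_prod => j; apply: measurable_wgt.
exact: measurable_quadform_slice.
Qed.

End slice_measurability.

(** [N] and [sigma] are given by equations: the length can then be substituted by the first block
    size plus the rest, and Lebesgue measure on the concatenation is a product to which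
    [radial_prod] applies. *)
Lemma radial_blocks k (n : 'I_k.+1 -> nat) (B : forall j, 'M[R[i]]_(n j))
    (alpha : 'I_k.+1 -> R[i]) N (sigma : forall j, 'I_(n j) -> 'I_N) :
  (forall j, 0 < n j)%N -> (forall j, posdefmx (B j)) ->
  (forall j, 0 < complex.Re (alpha j)) ->
  N = (\sum_j n j)%N ->
  (forall j i, sigma j i = (\sum_(l < k.+1 | (l < j)%N) n l + i)%N :> nat) ->
  radial (lebCn N)
    (fun t => \prod_j wgt (alpha j + 1) (quadform (B j) (slice sigma t j)))
    (fun t => \sum_j quadform (B j) (slice sigma t j))
    (\sum_j (alpha j + (n j)%:R))
    (\prod_j ((pi ^+ n j)%:C / \det (B j) *
      (cGamma (alpha j + (n j)%:R) / cGamma (n j)%:R))).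
Proof.
elim: k n B alpha N sigma => [|k IH] n B alpha N sigma n0 pB a0.
  rewrite !big_ord1 => NE; subst N => sigmaE.
  have := radial_block_weight (n0 ord0) (pB ord0) (a0 ord0).
  have E t : slice sigma t ord0 = cvec_of_tuple t.
    apply/colP => i; rewrite mxE; congr (cvec_of_tuple t _ _); apply/val_inj.
    by rewrite /= sigmaE big_pred0.
  by apply: eq_rel => // t; rewrite big_ord1 E.
rewrite big_ord_recl => NE; subst N => sigmaE.
pose n' j := n (lift ord0 j).
pose N' := (\sum_j n' j)%N.
pose sigma' j (i : 'I_(n' j)) : 'I_N' := tagnat.Rank j i.
have sE0 i : sigma ord0 i = lshift N' i.
  by apply/val_inj; rewrite /= sigmaE big_pred0.
have sE j i : sigma (lift ord0 j) i = rshift (n ord0) (sigma' j i).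
  apply/val_inj; transitivity (n ord0 + sigma' j i)%N => //.
  apply: (etrans (sigmaE _ _)).
  have -> : sigma' j i = (\sum_(l < k.+1 | (l < j)%N) n' l + i)%N :> nat.
    exact: tagnat.RankEsum.
  by rewrite [in LHS]big_mkcond [in RHS]big_mkcond big_ord_recl /= addnA.
have H0 := radial_block_weight (n0 ord0) (pB ord0) (a0 ord0).
have H1 := IH n' (fun j => B (lift ord0 j)) (fun j => alpha (lift ord0 j)) N' sigma'
  (fun j => n0 _) (fun j => pB _) (fun j => a0 _) erefl (fun j i => tagnat.RankEsum i).
have slice0 t u : slice sigma (tcat (t, u)) ord0 = cvec_of_tuple t.
  by apply/colP => i; rewrite mxE sE0 !cvec_of_tupleE tnth_lshift.
have slice1 t u j : slice sigma (tcat (t, u)) (lift ord0 j) = slice sigma' u j.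
  by apply/colP => i; rewrite !mxE sE tnth_rshift.
rewrite [X in radial _ _ _ X _]big_ord_recl [X in radial _ _ _ _ X]big_ord_recl.
have s0 : 0 < complex.Re (alpha ord0 + (n ord0)%:R).
  by rewrite Re_cD Re_natr addr_gt0// ltr0n.
have s1 : 0 < complex.Re (\sum_j (alpha (lift ord0 j) + (n (lift ord0 j))%:R)).
  rewrite raddf_sum /= big_ord_recl ltr_wpDr//.
    by apply: sumr_ge0 => j _; rewrite Re_cD Re_natr addr_ge0// ltW.
  by rewrite Re_cD Re_natr addr_gt0// ltr0n.
have mw := @measurable_prod_slice _ _ n sigma B alpha.
have mq := @measurable_sum_slice _ _ n sigma B.
have H2 := radial_prod s0 s1 (measurable_wgt _ (measurable_quadform_cvec _))
  (measurable_quadform_cvec _) (measurable_prod_slice _ _ _) (measurable_sum_slice _ _) H0 H1.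
have R1 := rel_image_sym (@measurable_tcat R _ _) (@lebCn_cat R _ _) mw mq.
apply: (rel_trans1 mw mq _ _ R1 _).
- exact: cmeasurableT_comp mw (@measurable_tcat R _ _).
- exact: measurableT_comp mq (@measurable_tcat R _ _).
apply: eq_rel H2 => // -[t u]; rewrite [RHS]big_ord_recl /= slice0.
  by under [in RHS]eq_bigr do rewrite slice1.
by under [in RHS]eq_bigr do rewrite slice1.
Qed.

End blocks.

(** * The Dirichlet average *)

Section dirichlet_average.
Context {R : realType}.
Local Notation RT := (measurableTypeR R).
Local Notation leb := (@lebesgue_measure R).
Local Notation lebCn := (@lebesgue_measureCn R).
Local Open Scope ring_scope.

Lemma blocks_slice k (n : 'I_k -> nat) (t : (\sum_j n j).-tuple (RT * RT)) j :
  blocks t j = slice (fun j (i : 'I_(n j)) => tagnat.Rank j i) t j.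
Proof. by apply/colP => i; rewrite !mxE. Qed.

(** This matches the nonzero blocks of the Dirichlet domain with the points where [wgt] is not cut
    off. *)
Lemma quadform_gt0 m (A : 'M[R[i]]_m) X : posdefmx A ->
  (0 < quadform A X) = (X != 0).
Proof.
move=> [_ pA]; have [->|X0] := eqVneq X 0.
  by rewrite /quadform mulmx0 mxE ltxx.
by have := pA X X0; rewrite ltcE => /andP[_].
Qed.

Lemma measurable_lt_set d (T : measurableType d) (u v : T -> R) :
  measurable_fun setT u -> measurable_fun setT v -> measurable [set x | u x < v x].
Proof.
move=> mu mv; rewrite -[X in measurable X]setTI.
exact: (measurable_fun_ltr mu mv measurableT (Y := [set true])).
Qed.

Lemma prod_eq0 k (F : 'I_k -> R[i]) j : F j = 0 -> \prod_j F j = 0.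
Proof. by move=> Fj; rewrite (bigD1 j)//= Fj mul0r. Qed.

Section average.
Variables (k : nat) (n : 'I_k.+1 -> nat) (B : forall j, 'M[R[i]]_(n j)).
Variables (alpha : 'I_k.+2 -> R[i]) (h : R[i]).
Local Notation inj := (widen_ord (leqnSn k.+1)).
Local Notation a := (alpha ord_max).
Local Notation s := (\sum_(j < k.+1) (alpha (inj j) + (n j)%:R)).
Local Notation N := (\sum_(j < k.+1) n j)%N.
Hypotheses (n_gt0 : forall j, (0 < n j)%N) (B_posdef : forall j, posdefmx (B j)).
Hypothesis alpha_gt0 : forall j, 0 < complex.Re (alpha j).
Hypothesis h_gt : 0 < complex.Re (s + h).

Let sigma j (i : 'I_(n j)) : 'I_N := tagnat.Rank j i.
Let w (t : N.-tuple (RT * RT)) :=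
  \prod_j wgt (alpha (inj j) + 1) (quadform (B j) (slice sigma t j)).
Let q (t : N.-tuple (RT * RT)) := \sum_j quadform (B j) (slice sigma t j).
Let D := [set t : N.-tuple (RT * RT) | dirichlet_domain B (blocks t)].

(* On (0, 1), r ^ h (1 - r) ^ (a - 1). *)
Let g (r : RT) : R[i] := wgt (h + 1) r * wgt a (1 - r).

Let C : R[i] := \prod_j ((pi ^+ n j)%:C / \det (B j) *
  (cGamma (alpha (inj j) + (n j)%:R) / cGamma (n j)%:R)).

Let s_gt0 : 0 < complex.Re s.
Proof.
rewrite raddf_sum /= big_ord_recl ltr_wpDr//.
  by apply: sumr_ge0 => j _; rewrite Re_cD Re_natr addr_ge0// ltW.
by rewrite Re_cD Re_natr addr_gt0// ltr0n.
Qed.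

Let radial_w : radial (lebCn N) w q s C.
Proof.
apply: radial_blocks => // j i; exact: tagnat.RankEsum.
Qed.

(** Inside the domain every [wgt] is a genuine power. Outside it, either some block is zero and its
    weight in [w] vanishes, or the sum of the forms is at least [1] and [wgt a (1 - q t)]
    vanishes. *)
Let integrandE : (fun t => if t \in D then
    phi9 B h (blocks t) * dirichlet_density B alpha (blocks t) else 0) =
  fun t => dirichlet_const B alpha * (w t * g (q t)).
Proof.
apply/funext => t.
have blocksE j : quadform (B j) (slice sigma t j) = quadform (B j) (blocks t j).
  by rewrite blocks_slice.
have qE : q t = \sum_j quadform (B j) (blocks t j) by apply: eq_bigr.
have wE : w t = \prod_j wgt (alpha (inj j) + 1) (quadform (B j) (blocks t j)).
  by apply: eq_bigr => j _; rewrite blocksE.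
rewrite wE /g qE; case: ifPn => tD.
  have [X0 q1] : dirichlet_domain B (blocks t) by exact: set_mem tD.
  have q0 j : 0 < quadform (B j) (blocks t j) by rewrite quadform_gt0.
  have Q0 : 0 < \sum_j quadform (B j) (blocks t j).
    apply: (lt_le_trans (q0 ord0)); rewrite big_ord_recl lerDl.
    by apply: sumr_ge0 => j _; apply/ltW/q0.
  set Q := \sum_j _ in q1 Q0 *.
  have -> : wgt (h + 1) Q = cpow Q h by rewrite /wgt Q0 addrK.
  have -> : wgt a (1 - Q) = cpow (1 - Q) (a - 1) by rewrite /wgt subr_gt0 q1.
  have -> : \prod_j wgt (alpha (inj j) + 1) (quadform (B j) (blocks t j)) =
      \prod_j cpow (quadform (B j) (blocks t j)) (alpha (inj j)).
    by apply: eq_bigr => j _; rewrite /wgt q0 addrK.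
  by rewrite /phi9 /dirichlet_density -/Q mulrCA -!mulrA mulrCA; congr (_ * _); rewrite mulrCA.
suff -> : \prod_j wgt (alpha (inj j) + 1) (quadform (B j) (blocks t j)) *
    (wgt (h + 1) (\sum_j quadform (B j) (blocks t j)) *
     wgt a (1 - \sum_j quadform (B j) (blocks t j))) = 0 by rewrite mulr0.
have [/forallP X0|/forallPn [j]] := boolP [forall j, blocks t j != 0].
  rewrite [wgt a _]/wgt subr_gt0; case: ifPn => [q1|_]; last by rewrite !mulr0.
  by case/negP: tD; apply: mem_set; split.
rewrite negbK => /eqP X0.
have qj0 : wgt (alpha (inj j) + 1) (quadform (B j) (blocks t j)) = 0.
  by rewrite X0 /quadform mulmx0 mxE /wgt ltxx.
by rewrite (prod_eq0 qj0) mul0r.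
Qed.

Let measurable_D : measurable D.
Proof.
have -> : D = \bigcap_(j in [set: 'I_k.+1]) [set t | 0 < quadform (B j) (slice sigma t j)] `&`
    [set t | q t < 1].
  apply/seteqP; split => t; rewrite /D /q /= /dirichlet_domain.
    move=> [X0 q1]; split; first by move=> j _ /=; rewrite -blocks_slice quadform_gt0.
    by under eq_bigr do rewrite -blocks_slice.
  move=> [X0 q1]; split.
    by move=> j; rewrite -(quadform_gt0 _ (B_posdef j)) blocks_slice; exact: X0.
  by under eq_bigr do rewrite blocks_slice.
apply: measurableI.
  apply: fin_bigcap_measurable => [|j _]; first exact: finite_finset.
  apply: measurable_lt_set => //; exact: measurable_quadform_slice.
by apply: measurable_lt_set => //; exact: measurable_sum_slice.
Qed.

Let cmeasurable_g : cmeasurable g.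
Proof.
by apply: cmeasurableM; apply: measurable_wgt => //; exact: measurable_funB.
Qed.

(** On the line only this Beta integrand of parameters [s + h] and [a] remains, which accounts for
    the hypothesis on [Re (s + h)]. *)
Let wgt_gE : (fun r : RT => wgt s r * g r) = (fun r : RT => wgt (s + h) r * wgt a (1 - r)).
Proof.
apply/funext => r; rewrite /g mulrA; congr (_ * _).
rewrite /wgt; case: ifPn => _; last by rewrite mul0r.
by rewrite -cpowD; congr cpow; ring.
Qed.

Let integrable_wg : cintegrable (lebCn N) setT (fun t => w t * g (q t)).
Proof.
have mw : cmeasurable w by exact: measurable_prod_slice.
have mq : measurable_fun setT q by exact: measurable_sum_slice.
have ms : cmeasurable (wgt s : RT -> R[i]) by exact: measurable_wgt.
apply/(rel_cintegrable mw mq ms _ cmeasurable_g radial_w).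
  exact: measurable_id.
by rewrite /= wgt_gE; exact: cintegrable_wgtB.
Qed.

Lemma dirichlet_integrable_phi9 : dirichlet_integrable B alpha (phi9 B h).
Proof.
apply/(cintegrable_mkcond _ _ measurable_D); rewrite integrandE.
exact: cintegrableM.
Qed.

Lemma dirichlet_average_phi9 : dirichlet_average B alpha (phi9 B h) =
  (cGamma (s + h) / cGamma s) * (cGamma (s + a) / cGamma (s + a + h)).
Proof.
rewrite /dirichlet_average cintegral_mkcond integrandE.
rewrite (cintegralM _ integrable_wg) (radial_w.2 _ cmeasurable_g integrable_wg) /=.
rewrite wgt_gE -/(cBeta (s + h) a).
have sha : 0 < complex.Re (s + a + h).
  by rewrite addrAC Re_cD addr_gt0.
have := cBetaM h_gt (alpha_gt0 ord_max); rewrite addrAC => BE.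
have sE : \sum_(j < k.+2) alpha j + \sum_(j < k.+1) (n j)%:R = s + a.
  by rewrite big_ord_recr /= addrAC -big_split.
rewrite /dirichlet_const sE.
set P := \prod_(j < k.+1) _.
(* The product over blocks in [dirichlet_const] is the inverse of the radial constant, so no trace
   of the matrices remains. *)
have PC : P * C = 1.
  rewrite /P /C -big_split /= big1// => j _.
  have d0 := posdef_det_neq0 (B_posdef j).
  have pi0 : (pi ^+ n j)%:C != 0 :> R[i].
    by rewrite (inj_eq (@complexI R) _ 0) expf_neq0// gt_eqF// pi_gt0.
  have G1 : cGamma ((n j)%:R : R[i]) != 0 by rewrite cGamma_neq0// Re_natr ltr0n.
  have G2 : cGamma (alpha (inj j) + (n j)%:R) != 0.
    by rewrite cGamma_neq0// Re_cD Re_natr addr_gt0// ltr0n.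
  by field; rewrite d0 pi0 G1 G2.
have [g1 g2 g3] := And3 (cGamma_neq0 s_gt0) (cGamma_neq0 (alpha_gt0 ord_max)) (cGamma_neq0 sha).
have -> : cBeta (s + h) a = cGamma (s + h) * cGamma a / cGamma (s + a + h).
  by rewrite -BE mulfK.
rewrite mulrA.
have -> : P * (cGamma (s + a) / cGamma a) * (C / cGamma s) =
  (P * C) * (cGamma (s + a) / cGamma a / cGamma s) by ring.
rewrite PC; field.
by rewrite g1 g2 g3.
Qed.

End average.

End dirichlet_average.

(** Integrability is part of the conclusion because [cintegral] also assigns values to functions
    that are not integrable, so the equation alone would not say that the average exists. *)
Theorem mainTheorem10 (R : realType) (k : nat) (n : 'I_k -> nat)
    (B : forall j : 'I_k, 'M[R[i]]_(n j)) (alpha : 'I_k.+1 -> R[i]) (h : R[i])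
    (k_gt0 : (0 < k)%N) (n_gt0 : forall j, (0 < n j)%N)
    (B_posdef : forall j, posdefmx (B j))
    (alpha_gt0 : forall j, 0 < complex.Re (alpha j))
    (h_gt : 0 < complex.Re
       (\sum_(j < k) (alpha (widen_ord (leqnSn k) j) + (n j)%:R) + h)) :
  let s : R[i] := \sum_(j < k) (alpha (widen_ord (leqnSn k) j) + (n j)%:R) in
  let a : R[i] := alpha ord_max in
  dirichlet_integrable B alpha (phi9 B h) /\
  dirichlet_average B alpha (phi9 B h) =
    (cGamma (s + h) / cGamma s) * (cGamma (s + a) / cGamma (s + a + h)).
Proof.
case: k k_gt0 n B alpha n_gt0 B_posdef alpha_gt0 h_gt => // k _ n B alpha.
move=> n_gt0 B_posdef alpha_gt0 h_gt; split.
  exact: dirichlet_integrable_phi9.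
exact: dirichlet_average_phi9.
Qed.
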